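(* For all $n\ge 1$ and $k\in[n]$, the mapping $\varphi:\mathcal{A}_{n,k}\to\mathcal{T}_{n,k}$ (defined recursively in the context) is a bijection between $\mathcal{A}_{n,k}$, the set of alternating permutations $\pi$ of $[n]$ with $\pi_1=k$, and $\mathcal{T}_{n,k}$, the set of 0-1-2 increasing trees $T$ on $[n]$ with $p(T)=k$. It satisfies $$\pi_1=p(\varphi(\pi))\qquad\text{for every }\pi\in\mathcal{A}_{n,k}.$$
   Context: **Permutations.** $[n]:=\{1,2,\dots,n\}$. $\mathcal{A}_n$ is the set of alternating permutations of $[n]$, i.e. permutations $\pi=\pi_1\pi_2\cdots\pi_n$ of $[n]$ with $\pi_1>\pi_2<\pi_3>\pi_4<\cdots$. Put $\mathcal{A}_{n,k}=\{\pi\in\mathcal{A}_n:\pi_1=k\}$. **Trees.** A 0-1-2 increasing tree on a finite nonempty set $S$ of integers is a rooted tree with vertex set $S$ in which every vertex has at most two children, the children of a vertex are not ordered, and every non-root vertex is larger than its parent (so the root is $\min S$). $\mathcal{T}_n$ is the set of 0-1-2 increasing trees on $[n]$. The main chain of such a tree $T$ is the path that starts at the root and moves, at each vertex, to its smallest child, until a leaf is reached. That leaf is denoted $p(T)$. Put $\mathcal{T}_{n,k}=\{T\in\mathcal{T}_n:p(T)=k\}$. Two distinct vertices are siblings if they have the same parent. ''Relabeling'' a permutation or tree by a set means applying the order-preserving bijection between the label sets. **The mapping $\varphi:\mathcal{A}_{n,k}\to\mathcal{T}_{n,k}$.** For $n=1$ and $n=2$, $|\mathcal{A}_n|=|\mathcal{T}_n|=1$,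 and $\varphi$ sends the unique element of $\mathcal{A}_n$ to the unique element of $\mathcal{T}_n$. For $n\ge 3$ and $\pi\in\mathcal{A}_{n,k}$ (so $k=\pi_1$), $\varphi(\pi)$ is defined recursively as follows. (a) Suppose $\pi_2=k-1$. Let $i=\pi_3$, so that $i>k$. Let $\pi'\in\mathcal{A}_{n-2,i-2}$ be obtained by deleting $k$ and $k-1$ from $\pi$ and relabeling by $[n-2]$. Let $T'=\varphi(\pi')\in\mathcal{T}_{n-2,i-2}$, and let $T''$ be $T'$ relabeled by $\{1,\dots,k-2,k+1,\dots,n\}$. Let $m$ be the smallest vertex greater than $k$ on the main chain of $T''$, and let $j$ be the parent of $m$ in $T''$. Replace the edge $(j,m)$ by the two edges $(j,k-1)$ and $(k-1,m)$, so that $k-1$ is a child of $j$ and $m$ is a child of $k-1$, and add $k$ as a new leaf child of $k-1$. If $m$ is the root of $T''$ (this happens exactly when $k=2$), there is no $j$, and $k-1=1$ becomes the new root, with children $k=2$ and $m$. The resulting tree is $\varphi(\pi)$. (b) Suppose $\pi_2<k-1$. Let $\pi'\in\mathcal{A}_{n,k-1}$ be obtained from $\pi$ by exchanging the values $k-1$ and $k$, and let $T'=\varphi(\pi')\in\mathcal{T}_{n,k-1}$, so that $k-1=p(T')$ is a leaf of $T'$. (b1) If $k$ is a sibling of $k-1$ in $T'$, let $j$ be their common parent. Let $A$ be the subtree of $T'$ rooted at the smallest child of $k$ (empty if $k$ has no child), and let $B$ be the subtree rooted at the other child of $k$ (empty if $k$ has at most one child). Then $\varphi(\pi)$ is obtained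 from $T'$ by rearranging the part above $j$ as follows: the children of $j$ are $k-1$ and the root of $A$ (if $A$ is nonempty), and the children of $k-1$ are $k$, which is a leaf, and the root of $B$ (if $B$ is nonempty). The subtrees $A$ and $B$ and the rest of the tree are unchanged. (b2) If $k$ is not a sibling of $k-1$ in $T'$, then $\varphi(\pi)$ is obtained from $T'$ by exchanging the labels $k-1$ and $k$. *)

(* Defs.v *)
From HB Require Import structures.
From mathcomp Require Import all_boot finmap.
From mathcomp Require Import classical_sets functions.
From mathcomp Require Import zify.
Set Implicit Arguments.
Unset Strict Implicit.
Unset Printing Implicit Defensive.

Local Open Scope fset_scope.

(* Permutations are words pi_1 ... pi_n; nth 0 pi i is pi_(i+1), so a descent
   pi_1 > pi_2 occurs at index 0 and the descents are the even indices. *)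
Definition alternating (pi : seq nat) : Prop :=
  forall i, i.+1 < size pi ->
    if odd i then nth 0 pi i < nth 0 pi i.+1 else nth 0 pi i.+1 < nth 0 pi i.

Definition altperm (n : nat) : set (seq nat) :=
  [set pi | perm_eq pi (iota 1 n) /\ alternating pi]%classic.

Definition altperm_hd (n k : nat) : set (seq nat) :=
  [set pi | altperm n pi /\ head 0 pi = k]%classic.

(* An edge is a pair (parent, child).  The vertex set is recorded because the
   one-vertex trees have no edge. *)
Record rtree := RTree {
  verts : {fset nat};
  root : nat;
  edges : {fset nat * nat}
}.

Definition rooted_tree (T : rtree) : Prop :=
  [/\ root T \in verts T,
      forall u v, (u, v) \in edges T -> u \in verts T /\ v \in verts T,
      forall u, (u, root T) \notin edges T,
      forall v, v \in verts T -> v != root T ->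
        exists! u, (u, v) \in edges T
    & forall v, v \in verts T -> exists s,
        path (fun a b => (a, b) \in edges T) (root T) s /\ last (root T) s = v].

(* In increasing order; this only serves to pick the smallest child, and does
   not order the children of a vertex of an [rtree]. *)
Definition children (T : rtree) (v : nat) : seq nat :=
  [seq w <- sort leq (verts T) | (v, w) \in edges T].

Definition parent (T : rtree) (v : nat) : nat :=
  head 0 [seq u <- verts T | (u, v) \in edges T].

Definition siblings (T : rtree) (a b : nat) : bool :=
  (a != b) &&
  has (fun u => ((u, a) \in edges T) && ((u, b) \in edges T)) (verts T).

Definition tree012 (S : {fset nat}) (T : rtree) : Prop :=
  [/\ verts T = S,
      rooted_tree T,
      forall v, v \in verts T -> size (children T v) <= 2
    & forall u v, (u, v) \in edges T -> u < v].

(* m bounds the number of steps. *)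
Fixpoint chain_from (T : rtree) (m v : nat) : seq nat :=
  v :: match m, children T v with
       | m'.+1, c :: _ => chain_from T m' c
       | _, _ => [::]
       end.

Definition main_chain (T : rtree) : seq nat :=
  chain_from T #|` verts T| (root T).

Definition chain_end (T : rtree) : nat := last (root T) (main_chain T).

Definition trees (n : nat) : set rtree :=
  [set T | tree012 [fset x in iota 1 n] T]%classic.

Definition trees_end (n k : nat) : set rtree :=
  [set T | trees n T /\ chain_end T = k]%classic.

(* For increasing lists s and s' of the same length, the order-preserving
   bijection from s to s'. *)
Definition relab (s s' : seq nat) (x : nat) : nat := nth 0 s' (index x s).

Definition relabel (f : nat -> nat) (T : rtree) : rtree :=
  RTree (f @` verts T) (f (root T)) [fset (f e.1, f e.2) | e in edges T].

Definition swap (k : nat) : nat -> nat := [eta id with k |-> k.-1, k.-1 |-> k].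

Definition labels_but (n k : nat) : seq nat :=
  [seq x <- iota 1 n | (x != k.-1) && (x != k)].

(* Subdivides by k-1 the edge above m, the smallest vertex > k of the main chain,
   and hangs the leaf k on k-1; if m is the root, k-1 becomes the new root. *)
Definition insert_pair (k : nat) (T : rtree) : rtree :=
  let V := k.-1 |` (k |` verts T) in
  let m := head 0 (sort leq [seq x <- main_chain T | k < x]) in
  if m == root T then
    RTree V k.-1 (edges T `|` [fset (k.-1, k); (k.-1, m)])
  else
    let j := parent T m in
    RTree V (root T)
      ((edges T `\ (j, m)) `|` [fset (j, k.-1); (k.-1, m); (k.-1, k)]).

(* For siblings k-1 (a leaf) and k with parent j: the subtrees at the smallest
   child a and at the other child b of k, if they exist, are moved to j and to
   k-1, which amounts to changing the parents of a and b; k is moved to k-1 as a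
   leaf. *)
Definition rearrange (k : nat) (T : rtree) : rtree :=
  let j := parent T k.-1 in
  let kept := [fset e in edges T | (e != (j, k)) && (e.1 != k)] in
  let moved := match children T k with
               | [::] => fset0
               | [:: a] => [fset (j, a)]
               | [:: a, b & _] => [fset (j, a); (k.-1, b)]
               end in
  RTree (verts T) (root T) (kept `|` moved `|` [fset (k.-1, k)]).

Definition shift_end (k : nat) (T : rtree) : rtree :=
  if siblings T k.-1 k then rearrange k T else relabel (swap k) T.

(* For w = k (k-1) w_3 ... w_n: the letters w_3, ..., w_n relabeled by [n-2]. *)
Definition delete_pair (k : nat) (w : seq nat) : seq nat :=
  map (relab (labels_but (size w) k) (iota 1 (size w - 2))) (drop 2 w).

Definition add_pair (n k : nat) (T : rtree) : rtree :=
  insert_pair k (relabel (relab (iota 1 (n - 2)) (labels_but n k)) T).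

Definition no_tree : rtree := RTree fset0 0 fset0.

(* If pi_2 = k-1, the recursive call is on a shorter word; if pi_2 < k-1, it is on
   a word of the same length whose first letter is smaller.  The structural
   arguments s and h bound the length and the first letter, see phiE below.  The
   value at words that are not alternating permutations is meaningless. *)
Fixpoint phi_rec (s : nat) : nat -> seq nat -> rtree :=
  fix phi_hd (h : nat) (w : seq nat) {struct h} : rtree :=
    match w with
    | [::] => no_tree
    | [:: _] => RTree [fset 1] 1 fset0
    | [:: _; _] => RTree [fset 1; 2] 1 [fset (1, 2)]
    | [:: k, l & _] =>
        if l.+1 == k then
          if s is s'.+1 then
            let w' := delete_pair k w in
            add_pair (size w) k (phi_rec s' (head 0 w') w')
          else no_tree
        else if l.+1 < k then
          if h is h'.+1 then shift_end k (phi_hd h' (map (swap k) w))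
          else no_tree
        else no_tree
    end.

Definition phi (w : seq nat) : rtree := phi_rec (size w) (head 0 w) w.

Lemma phi_rec_step s h k l i v (w := [:: k, l, i & v]) :
  phi_rec s.+1 h.+1 w =
    if l.+1 == k then
      add_pair (size w) k (phi_rec s (head 0 (delete_pair k w)) (delete_pair k w))
    else if l.+1 < k then shift_end k (phi_rec s.+1 h (map (swap k) w))
    else no_tree.
Proof. by []. Qed.

Lemma phi_recE s h w :
  size w <= s -> head 0 w <= h -> phi_rec s h w = phi w.
Proof.
suff main N M : forall s h s' h' w, size w < N -> head 0 w < M ->
    size w <= s -> size w <= s' -> head 0 w <= h -> head 0 w <= h' ->
    phi_rec s h w = phi_rec s' h' w.
  by move=> ws wh; apply: (main (size w).+1 (head 0 w).+1).
elim: N M => [//|N IHN] M; clear s h w; elim: M => [//|M IHM] s h s' h' w.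
case: w => [|k [|l [|i v]]]; try by case: s s' h h' => [|s] [|s'] [|h] [|h'].
case: s => [//|s]; case: s' => [//|s'].
case: k => [|k]; first by case: h h' => [|h] [|h'].
case: h => [//|h]; case: h' => [//|h'] wN wM ws ws' wh wh'.
rewrite !phi_rec_step; set w' := delete_pair _ _.
have sw' : size w' = (size v).+1 by rewrite size_map size_drop /=; lia.
rewrite /= in wN wM ws ws' wh wh'.
case: ifP => _.
  by congr add_pair; apply: (IHN (head 0 w').+1); rewrite // sw'; lia.
case: ifP => // _; congr shift_end.
have hd : head 0 (map (swap k.+1) [:: k.+1, l, i & v]) = k by rewrite /= /swap /= eqxx.
by apply: IHM; rewrite ?hd // size_map.
Qed.

(* The recursion defining phi, free of the bounds. *)
Lemma phiE w :
  phi w =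
    match w with
    | [::] => no_tree
    | [:: _] => RTree [fset 1] 1 fset0
    | [:: _; _] => RTree [fset 1; 2] 1 [fset (1, 2)]
    | [:: k, l & _] =>
        if l.+1 == k then add_pair (size w) k (phi (delete_pair k w))
        else if l.+1 < k then shift_end k (phi (map (swap k) w))
        else no_tree
    end.
Proof.
case: w => [|k [|l [|i v]]]; [by [] | by case: k | by case: k |].
case: k => [|k].
  have -> : phi [:: 0, l, i & v] = no_tree by [].
  by rewrite eqn0Ngt ltn0.
have {1}-> : phi [:: k.+1, l, i & v] = phi_rec (size v).+3 k.+1 [:: k.+1, l, i & v].
  by [].
rewrite phi_rec_step.
have hd : head 0 (map (swap k.+1) [:: k.+1, l, i & v]) = k.
  by rewrite /= /swap /= eqxx.
rewrite (@phi_recE (size v).+2); last by [].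
  by rewrite (@phi_recE (size v).+3) ?hd ?size_map.
by rewrite size_map size_drop /=; lia.
Qed.

(* Main.v *)
Require Import Defs.
From mathcomp Require Import all_boot finmap.
From mathcomp Require Import classical_sets functions.
From mathcomp Require Import zify boolp.
(* [root] would otherwise denote the [root] of [fingraph]. *)
Import Defs.
Set Implicit Arguments.
Unset Strict Implicit.
Unset Printing Implicit Defensive.

(* A tree is described by its parent function.  Its labels are positive, so the
   value 0 marks the root and 0 serves as a virtual parent of the root; cases
   (a), (b1), (b2) then become pointwise modifications of the parent function,
   each with an explicit inverse.  For n >= 3 and k >= 2, let T be a tree whose
   main chain ends at k.
   If k is not a child of k-1, then T comes from (b2).
   If k is a child of k-1, k-1 has another child m, and every sibling of k-1
   exceeds m, then T comes from (a).
   In the remaining case T comes from (b1).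
   Hence (b) is a bijection from the trees with end k-1 onto those with end k
   not produced by (a), and (a) is a bijection from the trees on n-2 vertices
   with end at least k-1 onto the others.  Deleting the first two letters of pi
   when pi_2 = k-1, and exchanging k-1 and k when pi_2 < k-1, decomposes the
   alternating permutations in the same way, so the theorem follows by induction
   on n and k. *)

(** * Parent functions and main chains *)

(** The main chain is what makes the three images distinguishable. In (a), m is the smallest child
    of j, so once k-1 takes its place all siblings of k-1 exceed m. In (b1), the smaller child of k
    goes to j and the larger one to k-1, so a second child of k-1 always comes with a smaller
    sibling of k-1. In (b2), the new parent of k is the old parent of k-1, hence less than k-1. None
    of the operations records which vertices it moved; they are recovered from these inequalities.
    The bound k-1 on the end in (a) is the condition pi_3 > k after subtracting 2. Since
    [main_chain] is computed with a step bound on sorted lists of children, chains are followed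
    through the modifications by the inductive predicate [on_chain], and the two notions are then
    compared once and for all. *)

(* The virtual parent 0 has exactly one child, the root. *)
Definition ptree (S : pred nat) (f : nat -> nat) : Prop :=
  [/\ exists2 r, S r & f r = 0,
      forall v, S v -> f v < v,
      forall v, S v -> f v = 0 \/ S (f v),
      forall a b, S a -> S b -> f a = 0 -> f b = 0 -> a = b
    & forall a b c, S a -> S b -> S c -> f a = f b -> f b = f c ->
        a = b \/ b = c \/ a = c].

Definition min_child (S : pred nat) (f : nat -> nat) (v : nat) : Prop :=
  S v /\ forall w, S w -> f w = f v -> v <= w.

(* The main chain, preceded by the virtual parent 0. *)
Inductive on_chain (S : pred nat) (f : nat -> nat) : nat -> Prop :=
| on_chain0 : on_chain S f 0
| on_chainS v : on_chain S f (f v) -> min_child S f v -> on_chain S f v.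

(** [chain_end] freed of its step bound; [chain_endP] relates the two. *)
Definition leaf_end (S : pred nat) (f : nat -> nat) (k : nat) : Prop :=
  [/\ S k, on_chain S f k & forall w, S w -> f w <> k].

(** Compatibility is asked only at chain vertices up to [v], so a modification of the tree beyond
    [v] is harmless. With [g := id] this compares two trees that share the lower part of their
    chains. *)
Lemma on_chain_map (g : nat -> nat) (S : pred nat) f (S' : pred nat) f' v :
  (forall w, S w -> f w < w) -> g 0 = 0 ->
  (forall w, w <= v -> on_chain S f w -> min_child S f w ->
     f' (g w) = g (f w) /\ min_child S' f' (g w)) ->
  on_chain S f v -> on_chain S' f' (g v).
Proof.
move=> flt g0 H C; elim: C H => [|{}v C IH [Sv mv]] H.
  by rewrite g0; constructor.
have [e m'] := H v (leqnn v) (on_chainS C (conj Sv mv)) (conj Sv mv).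
apply: on_chainS => //; rewrite e; apply: IH => w wv; apply: H.
by have := flt v Sv; lia.
Qed.

Section Chain.
Variables (S : pred nat) (f : nat -> nat).
Hypothesis fS : ptree S f.

Lemma ptree_pos v : S v -> 0 < v.
Proof. by case: fS => _ /(_ v) lt _ _ _ /lt; lia. Qed.

Lemma on_chain_inv v : on_chain S f v -> 0 < v ->
  [/\ S v, on_chain S f (f v) & min_child S f v].
Proof. by case=> [//|w C m _]; split=> //; case: m. Qed.

Lemma min_child_uniq u v :
  min_child S f u -> min_child S f v -> f u = f v -> u = v.
Proof.
by move=> [Su mu] [Sv mv] e; apply/eqP; rewrite eqn_leq mu // mv.
Qed.

(** If the parents differ, the larger one again lies between a chain vertex and its parent, hence by
    induction equals that vertex, which is absurd. So the parents agree, and a vertex has only one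
    smallest child. *)
Lemma on_chain_between u v :
  on_chain S f u -> on_chain S f v -> f v < u -> u <= v -> u = v.
Proof.
have [_ flt _ _ _] := fS.
have [N] := ubnP (u + v); elim: N u v => // N IH u v lN Cu Cv vu uv.
have [] : 0 < u /\ 0 < v by lia.
case/(on_chain_inv Cu) => Su Cfu mu /(on_chain_inv Cv)[Sv Cfv mv].
have fu := flt u Su; have fv := flt v Sv.
have [lt|gt|e] := ltngtP (f u) (f v); last exact: min_child_uniq.
- by have := IH (f v) u _ Cfv Cu; lia.
by have := IH (f u) v _ Cfu Cv; lia.
Qed.

(** The edge of the chain that straddles the threshold [k]; its child end is the m of case (a). *)
Lemma on_chain_cross k e : on_chain S f e -> k < e ->
  exists m, [/\ on_chain S f m, f m <= k, k < m & m <= e].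
Proof.
have [_ flt _ _ _] := fS.
elim=> [//|v C IH [Sv mv]] kv; have fv := flt v Sv.
case: (leqP (f v) k) => [le|/IH[m [Cm fm km mf]]].
  by exists v; split=> //; constructor.
by exists m; split=> //; lia.
Qed.

Lemma on_chain_cross_min k m x :
  on_chain S f m -> f m <= k -> on_chain S f x -> k < x -> m <= x.
Proof.
move=> Cm fm Cx kx; case: (leqP m x) => // xm.
by have := on_chain_between Cx Cm; lia.
Qed.

Lemma on_chain_step v x : S v -> on_chain S f v -> on_chain S f x -> v < x ->
  exists c, [/\ S c, on_chain S f c, min_child S f c, f c = v & c <= x].
Proof.
move=> Sv Cv Cx vx; have [m [Cm fm vm mx]] := on_chain_cross Cx vx.
have m0 : 0 < m by lia.
have [Sm _ mm] := on_chain_inv Cm m0.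
by exists m; split=> //; have := on_chain_between Cv Cm; lia.
Qed.

Lemma leaf_end_max a x : leaf_end S f a -> on_chain S f x -> x <= a.
Proof.
case=> Sa Ca leafa Cx; case: (leqP x a) => // ax.
by have [c [Sc _ _ /leafa]] := on_chain_step Sa Ca Cx ax.
Qed.

Lemma leaf_end_uniq a b : leaf_end S f a -> leaf_end S f b -> a = b.
Proof.
move=> Ea Eb; have [_ Ca _] := Ea; have [_ Cb _] := Eb.
by apply/eqP; rewrite eqn_leq (leaf_end_max Eb Ca) (leaf_end_max Ea Cb).
Qed.

End Chain.

(** Passing to the smallest child increases the label, which [N] bounds, so the chain stops. This
    provides the end of a tree obtained by undoing (a), of which only the chain vertex m is
    known. *)
Lemma leaf_end_exists (S : pred nat) f N v :
  ptree S f -> (forall w, S w -> w <= N) -> S v -> on_chain S f v ->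
  exists2 e, leaf_end S f e & v <= e.
Proof.
move=> fS SN; have [_ flt _ _ _] := fS.
have [M] := ubnP (N - v); elim: M v => // M IH v lM Sv Cv.
case: (boolP (has (fun w => S w && (f w == v)) (iota 0 N.+1))); last first.
  move/hasPn=> no; exists v => //; split=> // w Sw fw.
  have := no w; rewrite mem_iota Sw fw eqxx /=.
  by have := SN w Sw; lia.
case/hasP=> w0 _ ex0; have ex : exists w, S w && (f w == v) by exists w0.
case: (ex_minnP ex) => c /andP[Sc /eqP fc] cmin.
have mc : min_child S f c.
  by split=> // w Sw; rewrite fc => fw; apply: cmin; rewrite Sw fw eqxx.
have vc : v < c by rewrite -fc; apply: flt.
have cN := SN c Sc.
have Cc : on_chain S f c by constructor; rewrite ?fc.
have [|e Ee ce] := IH c _ Sc Cc; first lia.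
by exists e => //; lia.
Qed.

(** * Trees described by parent functions *)

(** The condition [0 < u] removes the virtual edge from 0 to the root. Outside [S] nothing is said
    about [f]. *)
Definition represents (S : pred nat) (f : nat -> nat) (T : rtree) : Prop :=
  [/\ forall v, (v \in verts T) = S v, S (root T), f (root T) = 0
    & forall u v, ((u, v) \in edges T) = [&& S v, f v == u & 0 < u]].

Lemma head_sort_leq (s : seq nat) m :
  m \in s -> (forall x, x \in s -> m <= x) -> head 0 (sort leq s) = m.
Proof.
move=> ms mmin; have := sort_sorted leq_total s; have := mem_sort leq s.
case: (sort leq s) => [|x t] mem so; first by move: (mem m); rewrite ms.
apply/eqP; rewrite eqn_leq mmin /= -?mem ?mem_head // andbT.
move: ms; rewrite -mem inE => /predU1P[->//|mt].
by have /allP := order_path_min leq_trans so; apply.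
Qed.

Lemma head_mem (s : seq nat) x0 : s != [::] -> head x0 s \in s.
Proof. by case: s => // x s _; rewrite mem_head. Qed.

Lemma count_lt (T : eqType) (p q : pred T) s x :
  subpred p q -> x \in s -> q x -> ~~ p x -> count p s < count q s.
Proof.
move=> pq + qx px; elim: s => //= y s IH; rewrite inE => /predU1P[<-|/IH].
  by rewrite qx (negbTE px) ltnS sub_count.
by have := pq y; case: (p y) => [->|_] //; case: (q y); lia.
Qed.

Section Represents.
Variables (S : pred nat) (f : nat -> nat) (T : rtree).
Hypotheses (fT : represents S f T) (fS : ptree S f).

(** At the root, the default 0 of [head] in [parent] is exactly the virtual parent. *)
Lemma parent_rep v : S v -> parent T v = f v.
Proof.
case: fT => mv Sr fr me Sv; case: fS => _ flt fcl _ _.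
rewrite /parent; case: (posnP (f v)) => fv.
  rewrite (_ : [seq u <- _ | _] = [::]) ?fv //.
  by rewrite -(filter_pred0 (verts T)); apply: eq_filter => u; rewrite /= me fv; lia.
have : f v \in [seq u <- verts T | (u, v) \in edges T].
  by rewrite mem_filter me Sv eqxx fv /= mv; case: (fcl v Sv) => //; lia.
set s := [seq _ <- _ | _] => fs.
have : head 0 s \in s by apply: head_mem; case: s fs.
by rewrite mem_filter me => /andP[/and3P[_ /eqP]].
Qed.

Lemma represents_eq g : (forall v, S v -> f v = g v) -> represents S g T.
Proof.
case: fT => mv Sr fr me fg; split=> //; first by rewrite -fg.
by move=> u v; rewrite me; case Sv: (S v) => //=; rewrite fg.
Qed.

Lemma root_rep v : S v -> (v == root T) = (f v == 0).
Proof.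
case: fT => mv Sr fr me Sv; case: fS => _ _ _ f0 _.
by apply/eqP/eqP=> [->//|fv]; apply: f0.
Qed.

Lemma mem_children v w : (w \in children T v) = [&& S w, f w == v & 0 < v].
Proof.
case: fT => mv Sr fr me.
by rewrite mem_filter me mem_sort mv; case: (S w); rewrite //= andbT.
Qed.

Lemma children_sorted v : sorted ltn (children T v).
Proof.
rewrite ltn_sorted_uniq_leq /children filter_uniq ?sort_uniq ?fset_uniq //=.
by apply: sorted_filter; [apply: leq_trans | apply: sort_sorted leq_total _].
Qed.

Lemma size_children v : size (children T v) <= 2.
Proof.
case: fS => _ _ _ _ f3.
have := mem_children v; have := children_sorted v.
case: (children T v) => [|a [|b [|c s]]] // so mc; exfalso.
have /and3P[Sa /eqP fa _] : [&& S a, f a == v & 0 < v] by rewrite -mc !inE eqxx.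
have /and3P[Sb /eqP fb _] : [&& S b, f b == v & 0 < v].
  by rewrite -mc !inE eqxx ?orbT.
have /and3P[Sc /eqP fc _] : [&& S c, f c == v & 0 < v].
  by rewrite -mc !inE eqxx ?orbT.
by have := f3 a b c Sa Sb Sc; move: so => /=; lia.
Qed.

Lemma children_head v : children T v != [::] ->
  [/\ S (head 0 (children T v)), f (head 0 (children T v)) = v
    & min_child S f (head 0 (children T v))].
Proof.
move=> ne; have := head_mem 0 ne; rewrite mem_children => /and3P[Sc /eqP fc v0].
split=> //; split=> // w Sw; rewrite fc => fw.
have : w \in children T v by rewrite mem_children Sw fw eqxx.
have := children_sorted v.
case: (children T v) => [//|c s] /= so; rewrite inE => /predU1P[->//|ws].
by have /allP/(_ w ws) := order_path_min ltn_trans so; apply: ltnW.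
Qed.

Lemma represents_tree012 (V : {fset nat}) :
  (forall v, (v \in V) = S v) -> tree012 V T.
Proof.
move=> mV; have [mv Sr fr me] := fT; have [_ flt fcl f0 _] := fS.
split; first by apply/fsetP=> v; rewrite mV mv.
- split=> [||u|v|v].
  + by rewrite mv.
  + move=> u v; rewrite me !mv => /and3P[Sv /eqP fv u0]; split=> //.
    by case: (fcl v Sv); rewrite fv //; lia.
  + by rewrite me fr; lia.
  + rewrite mv => Sv; rewrite root_rep // => fv.
    exists (f v); split; first by rewrite me Sv eqxx lt0n.
    by move=> u; rewrite me => /and3P[_ /eqP].
  + elim/ltn_ind: v => v IH; rewrite mv => Sv.
    case: (eqVneq v (root T)) => [->|]; first by exists [::].
    rewrite root_rep // => fv.
    have Sfv : S (f v) by case: (fcl v Sv) => // e; rewrite e in fv.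
    have [s [ps ls]] := IH (f v) (flt v Sv) (etrans (mv _) Sfv).
    exists (rcons s v); rewrite last_rcons rcons_path ps ls me Sv eqxx lt0n /=.
    by split.
- by move=> v _; apply: size_children.
by move=> u v; rewrite me => /and3P[Sv /eqP <- _]; apply: flt.
Qed.

Lemma chain_from_on_chain m v x :
  0 < v -> on_chain S f v -> x \in chain_from T m v -> on_chain S f x /\ 0 < x.
Proof.
elim: m v => [|m IH] v v0 Cv /=; first by rewrite inE => /eqP->.
rewrite inE => /predU1P[->//|].
have := @children_head v; case: (children T v) => [//|c s] /= /(_ isT)[Sc fc mc].
apply: IH; first exact: (ptree_pos fS Sc).
by constructor; rewrite ?fc.
Qed.

(* The number of vertices above v bounds the length of the chain from v. *)
Lemma last_chain_from m v :
  S v -> on_chain S f v -> count (ltn v) (verts T) <= m ->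
  leaf_end S f (last v (chain_from T m v)).
Proof.
have [mv Sr fr me] := fT; have [_ flt _ _ _] := fS.
have leafP u : S u -> on_chain S f u -> children T u = [::] -> leaf_end S f u.
  move=> Su Cu ch; split=> // w Sw fw.
  have : w \in children T u by rewrite mem_children Sw fw eqxx (ptree_pos fS Su).
  by rewrite ch.
elim: m v => [|m IH] v Sv Cv cnt.
  apply: leafP => //; case ch: (children T v) => [//|c s].
  have := @children_head v; rewrite ch => /(_ isT)[/= Sc fc _].
  have : has (ltn v) (verts T).
    by apply/hasP; exists c; rewrite ?mv //= -fc; apply: flt.
  by rewrite has_count; lia.
rewrite /=; case ch: (children T v) => [|c s]; first exact: leafP.
have := @children_head v; rewrite ch => /(_ isT)[/= Sc fc mc].
have -> : last v (chain_from T m c) = last c (chain_from T m c) by case: (m).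
apply: IH => //; first by constructor; rewrite ?fc.
have vc : v < c by rewrite -fc; apply: flt.
rewrite -ltnS; apply: leq_trans cnt.
apply: (@count_lt _ _ _ _ c); rewrite ?mv //= ?ltnn // => w; apply: ltn_trans vc.
Qed.

(** By [on_chain_step] the smallest child of [v] does not jump over [x], so every step of the
    recursion approaches [x]; the step bound is again the number of labels above [v]. *)
Lemma mem_chain_from m v x :
  S v -> on_chain S f v -> count (ltn v) (verts T) <= m ->
  on_chain S f x -> v <= x -> x \in chain_from T m v.
Proof.
have [mv Sr fr me] := fT; have [_ flt _ _ _] := fS.
elim: m v => [|m IH] v Sv Cv cnt Cx; rewrite leq_eqVlt => /predU1P[->|vx];
  try by rewrite /= mem_head.
  have x0 : 0 < x by lia.
  have [Sx _ _] := on_chain_inv Cx x0.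
  have : has (ltn v) (verts T) by apply/hasP; exists x; rewrite ?mv.
  by rewrite has_count; lia.
have [c' [Sc' Cc' mc' fc' c'x]] := on_chain_step fS Sv Cv Cx vx.
have : c' \in children T v by rewrite mem_children Sc' fc' eqxx (ptree_pos fS Sv).
have := @children_head v; rewrite /= inE; case: (children T v) => [//|c s].
move=> /(_ isT)[/= Sc fc mc] _; rewrite -fc' in fc.
have e := min_child_uniq mc mc' fc; rewrite e in fc *.
apply/orP; right; apply: IH => //.
have vc : v < c' by rewrite -fc'; apply: flt.
rewrite -ltnS; apply: leq_trans cnt.
apply: (@count_lt _ _ _ _ c'); rewrite ?mv //= ?ltnn // => w; apply: ltn_trans vc.
Qed.

Lemma on_chain_root : on_chain S f (root T).
Proof.
have [mv Sr fr me] := fT; have [_ _ _ f0 _] := fS.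
apply: on_chainS; first by rewrite fr; constructor.
by split=> // w Sw; rewrite fr => fw; rewrite (f0 (root T) w).
Qed.

Lemma fuel_main_chain : count (ltn (root T)) (verts T) <= #|` verts T|.
Proof. exact: count_size. Qed.

Lemma root_min v : S v -> root T <= v.
Proof.
have [mv Sr fr me] := fT; have [_ flt fcl f0 _] := fS.
elim/ltn_ind: v => v IH Sv; have [fv|Sf] := fcl v Sv.
  by rewrite (f0 (root T) v).
by apply: leq_trans (IH _ (flt v Sv) Sf) _; apply/ltnW/flt.
Qed.

Lemma mem_main_chain v : v \in main_chain T <-> on_chain S f v /\ 0 < v.
Proof.
have [_ Sr _ _] := fT.
split=> [|[Cv v0]].
  by apply: chain_from_on_chain; [apply: (ptree_pos fS Sr) | apply: on_chain_root].
have [Sv _ _] := on_chain_inv Cv v0.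
apply: mem_chain_from => //; [exact: on_chain_root | exact: fuel_main_chain |].
exact: root_min.
Qed.

Lemma leaf_end_chain_end : leaf_end S f (chain_end T).
Proof.
have [_ Sr _ _] := fT.
by apply: last_chain_from => //; [apply: on_chain_root | apply: fuel_main_chain].
Qed.

Lemma chain_endP k : chain_end T = k <-> leaf_end S f k.
Proof.
split=> [<-|]; first exact: leaf_end_chain_end.
exact: (leaf_end_uniq fS leaf_end_chain_end).
Qed.

End Represents.

Lemma represents_inj S f T T' :
  represents S f T -> represents S f T' -> ptree S f -> T = T'.
Proof.
case: T T' => V r E [V' r' E'] [/= mv Sr fr me] [/= mv' Sr' fr' me'] [_ _ _ f0 _].
rewrite (f0 r r') //; congr RTree; apply/fsetP; first by move=> v; rewrite mv mv'.
by case=> u v; rewrite me me'.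
Qed.

(** As 0 is not a label, [parent T v = 0] singles out the root. Uniqueness of parents makes [parent]
    agree with every edge, and three distinct vertices with a common parent would be three entries
    of a list of at most two children. *)
Lemma tree012_represents (V : {fset nat}) (S : pred nat) T :
  (forall v, (v \in V) = S v) -> ~~ S 0 -> tree012 V T ->
  represents S (parent T) T /\ ptree S (parent T).
Proof.
move=> mV S0 [VT [rT eT er eu reach] ch inc].
have mv v : (v \in verts T) = S v by rewrite VT mV.
have parE u v : (u, v) \in edges T -> parent T v = u.
  move=> uv; have [uT vT] := eT _ _ uv.
  have : u \in [seq u <- verts T | (u, v) \in edges T] by rewrite mem_filter uv.
  rewrite /parent; set s := [seq _ <- _ | _] => us.
  have : head 0 s \in s by apply: head_mem; case: s us.
  rewrite mem_filter => /andP[hv _].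
  have vr : v != root T by apply: contraTneq uv => ->; apply: er.
  by have [w [_ uw]] := eu v vT vr; rewrite -(uw u uv); apply/esym/uw.
have par0 : parent T (root T) = 0.
  by rewrite /parent (eq_filter (a2 := pred0)) ?filter_pred0 // => u;
     apply/negbTE/er.
have edge v : S v -> v != root T -> (parent T v, v) \in edges T.
  by rewrite -mv => vT vr; have [u [uv _]] := eu v vT vr; rewrite (parE _ _ uv).
have edgeS u v : (u, v) \in edges T -> [/\ S u, S v & 0 < u].
  move=> uv; have [] := eT _ _ uv; rewrite !mv => Su Sv; split=> //.
  by rewrite lt0n; apply: contraNneq S0 => <-.
have p0 v : S v -> parent T v = 0 -> v = root T.
  move=> Sv pv; apply/eqP/negPn/negP => vr.
  by have [_ _] := edgeS _ _ (edge v Sv vr); rewrite pv.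
have fT : represents S (parent T) T.
  split=> //; first by rewrite -mv.
  move=> u v; apply/idP/idP => [uv|/and3P[Sv /eqP<- pv]].
    by have [_ -> ->] := edgeS _ _ uv; rewrite (parE _ _ uv) eqxx.
  by apply: edge => //; apply: contraTneq pv => ->; rewrite par0.
split=> //; split.
- by exists (root T); rewrite -?mv.
- move=> v Sv; have [->|vr] := eqVneq v (root T); last exact/inc/edge.
  by rewrite par0 lt0n; apply: contraNneq S0 => <-; rewrite -mv.
- move=> v Sv; have [->|vr] := eqVneq v (root T); [by left | right].
  by have [] := edgeS _ _ (edge v Sv vr).
- by move=> a b Sa Sb /p0-> // /p0->.
move=> a b c Sa Sb Sc ab bc.
have [z|nz] := eqVneq (parent T a) 0.
  by left; rewrite (p0 a) // (p0 b) // -ab.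
have ea v : S v -> parent T v = parent T a -> v \in children T (parent T a).
  move=> Sv pv; rewrite mem_filter mem_sort mv Sv -pv edge //.
  by apply: contraNneq nz => vr; rewrite -pv vr par0.
have [|ab'] := eqVneq a b; first by left.
have [|bc'] := eqVneq b c; first by right; left.
have [|ac'] := eqVneq a c; first by right; right.
exfalso; have Spa : parent T a \in verts T.
  rewrite mv; have [] // := edgeS _ _ (edge a Sa _).
  by apply: contraNneq nz => ->; rewrite par0.
have := ch _ Spa; apply/negP; rewrite -ltnNge.
apply: (@leq_trans (size [:: a; b; c])) => //; apply: uniq_leq_size.
  by rewrite /= !inE negb_or ab' ac' bc'.
by move=> x; rewrite !inE => /or3P[]/eqP->; apply: ea; rewrite // -?bc -?ab.
Qed.

(** Preimages are found as parent functions; this turns them back into trees. *)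
Definition tree_of (S : seq nat) (f : nat -> nat) : rtree :=
  RTree [fset x in S]%fset (head 0 [seq v <- S | f v == 0])
    [fset e in [seq (f v, v) | v <- S & 0 < f v]]%fset.

Lemma tree_of_represents (S : pred nat) (s : seq nat) f :
  (forall v, (v \in s) = S v) -> ptree S f -> represents S f (tree_of s f).
Proof.
move=> sS [[r Sr fr] _ _ _ _].
have : head 0 [seq v <- s | f v == 0] \in [seq v <- s | f v == 0].
  apply: head_mem; have : r \in [seq v <- s | f v == 0].
    by rewrite mem_filter fr eqxx sS.
  by case: [seq _ <- _ | _].
rewrite mem_filter => /andP[/eqP fh Sh].
split=> //= [v||u v]; rewrite ?inE -?sS //.
apply/mapP/and3P => [[w]|[Sv /eqP<- fv]].
  by rewrite mem_filter => /andP[w0 Sw] [-> ->].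
by exists v; rewrite // mem_filter fv.
Qed.

(** * The tree operations on parent functions *)

(** Fixing 0 carries the virtual parent along, so the root goes to the root. *)
Definition label_bij (g h : nat -> nat) (S S' : pred nat) : Prop :=
  [/\ g 0 = 0, h 0 = 0, forall x, S x -> S' (g x) /\ h (g x) = x
    & forall y, S' y -> S (h y) /\ g (h y) = y].

Lemma label_bij_sym g h S S' : label_bij g h S S' -> label_bij h g S' S.
Proof. by case. Qed.

(** Order has to be preserved along edges only, because the exchange of k-1 and k is not
    monotone. *)
Lemma ptree_relabel g h S S' f : label_bij g h S S' -> ptree S f ->
  (forall v, S v -> g (f v) < g v) -> ptree S' (fun v => g (f (h v))).
Proof.
move=> [g0 h0 gS hS] [[r Sr fr] flt fcl f0 f3] gf.
have ginj a b : S a -> S b -> g (f a) = g (f b) -> f a = f b.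
  move=> Sa Sb; have : h (g (f a)) = f a.
    by case: (fcl a Sa) => [->|/gS[]//]; rewrite g0.
  have : h (g (f b)) = f b by case: (fcl b Sb) => [->|/gS[]//]; rewrite g0.
  by move=> {2}<- {2}<- ->.
have hinj a b : S' a -> S' b -> h a = h b -> a = b.
  by move=> /hS[_ {2}<-] /hS[_ {2}<-] ->.
split.
- by have [S'r hr] := gS r Sr; exists (g r); rewrite // hr fr.
- by move=> v /hS[Sh gh]; rewrite -{2}gh; apply: gf.
- move=> v /hS[Sh gh]; case: (fcl _ Sh) => [->|/gS[]]; first by left.
  by right.
- move=> a b Sa Sb; have [Ha _] := hS a Sa; have [Hb _] := hS b Sb.
  move=> ga gb; apply: hinj => //; apply: f0 => //.
    have [//|/gS[_]] := fcl _ Ha; by rewrite ga h0.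
  have [//|/gS[_]] := fcl _ Hb; by rewrite gb h0.
move=> a b c Sa Sb Sc; have [Ha _] := hS a Sa; have [Hb _] := hS b Sb.
have [Hc _] := hS c Sc => /ginj ab /ginj bc.
by case: (f3 _ _ _ Ha Hb Hc (ab Ha Hb) (bc Hb Hc)) => [|[]] /hinj; auto.
Qed.

Lemma relabel_represents g h S S' f T : label_bij g h S S' -> ptree S f ->
  represents S f T -> represents S' (fun v => g (f (h v))) (relabel g T).
Proof.
move=> [g0 h0 gS hS] fS [mv Sr fr me]; have [_ flt fcl _ _] := fS.
have Sf v : S v -> 0 < f v -> S (f v) by move=> /fcl[->|].
split=> /=; first 3 last.
- move=> u v; apply/imfsetP/and3P => [[[a b] /= + [-> ->]]|[S'v /eqP<- gu]].
    rewrite me => /and3P[Sb /eqP fb a0]; have [-> hb] := gS b Sb.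
    split=> //; first by rewrite hb fb.
    have Sa : S a by rewrite -fb Sf ?fb.
    have [_ ha] := gS a Sa.
    by rewrite lt0n; apply: contraTneq a0 => ga; rewrite -ha ga h0.
  have [Sh gh] := hS v S'v; exists (f (h v), h v); last by rewrite /= gh.
  rewrite me Sh eqxx lt0n /=; apply: contraTneq gu => ->; by rewrite g0.
- move=> v; apply/imfsetP/idP => [[a /= + ->]|/hS[Sh gh]].
    by rewrite mv => /gS[].
  by exists (h v); rewrite //= mv.
- by case: (gS _ Sr).
by have [_ ->] := gS _ Sr; rewrite fr.
Qed.

Lemma eq_relabel g g' S f T : represents S f T -> ptree S f ->
  (forall x, S x -> g x = g' x) -> relabel g T = relabel g' T.
Proof.
move=> [mv Sr fr me] [_ _ fcl _ _] gg; congr RTree; last 1 first.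
- apply: eq_in_imfset => //= -[a b] /=; rewrite me => /and3P[Sb /eqP fb a0].
  by rewrite !gg //; case: (fcl b Sb); rewrite fb // => a0'; rewrite a0' in a0.
- by apply: eq_in_imfset => //= x; rewrite mv; apply: gg.
exact: gg.
Qed.

(** If m was the root, [f m] is 0 and k-1 becomes the root, so both branches of [insert_pair] have
    this one formula. *)
Definition insert_par (k m : nat) (f : nat -> nat) (v : nat) : nat :=
  if (v == m) || (v == k) then k.-1 else if v == k.-1 then f m else f v.

Lemma insert_pair_represents S S' f k m T :
  represents S f T -> ptree S f -> 1 < k -> ~~ S k -> ~~ S k.-1 ->
  (forall v, S' v = [|| S v, v == k | v == k.-1]) ->
  on_chain S f m -> f m < k < m ->
  represents S' (insert_par k m f) (insert_pair k T).
Proof.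
move=> fT fS k1 Sk Sk1 S'E Cm /andP[fmk km].
have [mv Sr fr me] := fT; have [_ flt fcl f0 _] := fS.
have m0 : 0 < m by lia.
have [Sm _ mm] := on_chain_inv Cm m0.
rewrite /insert_pair.
(* A chain vertex above k whose parent is not above k is the least chain vertex above k. *)
have -> : head 0 (sort leq [seq x <- main_chain T | k < x]) = m.
  apply: head_sort_leq.
    by rewrite mem_filter km; apply/(mem_main_chain fT fS).
  move=> x; rewrite mem_filter => /andP[kx /(mem_main_chain fT fS)[Cx _]].
  exact: (on_chain_cross_min fS Cm (ltnW fmk) Cx kx).
rewrite (parent_rep fT fS) // (root_rep fT fS) //.
have mV v : (v \in k.-1 |` (k |` verts T))%fset = S' v.
  by rewrite !inE mv S'E; lia.
case: eqP => fm.
  split=> //= [||u v]; first by rewrite S'E eqxx !orbT.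
    by rewrite /insert_par fm eqxx; case: ifP => //; lia.
  rewrite !inE me S'E /insert_par !xpair_eqE.
  have [->|vm] := eqVneq v m; first by rewrite fm Sm /=; lia.
  have [->|vk] := eqVneq v k; first by rewrite (negbTE Sk) /=; lia.
  have [->|vk1] := eqVneq v k.-1; first by rewrite (negbTE Sk1) fm /=; lia.
  by rewrite /= !andbF !orbF.
split=> //= [||u v]; first by rewrite S'E Sr.
  rewrite /insert_par; have [e|_] := eqVneq (root T) m; first by rewrite -e fr in fm.
  have [e|_] := eqVneq (root T) k; first by rewrite e (negbTE Sk) in Sr.
  by have [e|_] := eqVneq (root T) k.-1; first by rewrite e (negbTE Sk1) in Sr.
rewrite !inE me S'E /insert_par !xpair_eqE.
have [->|vm] := eqVneq v m; first by rewrite Sm /=; lia.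
have [->|vk] := eqVneq v k; first by rewrite (negbTE Sk) /=; lia.
have [->|vk1] := eqVneq v k.-1; first by rewrite (negbTE Sk1) /=; lia.
by rewrite /= !andbF !orbF.
Qed.

(** The virtual parent has a single child, so distinct vertices with equal parent values have a
    genuine common parent. *)
Lemma siblings_represents S f T a b : represents S f T -> ptree S f ->
  S a -> S b -> siblings T a b = (a != b) && (f a == f b).
Proof.
move=> [mv Sr fr me] [_ _ fcl f0 _] Sa Sb; rewrite /siblings.
have [//|/= ab] := eqVneq a b.
apply/hasP/eqP => [[u _]|fab].
  by rewrite !me => /andP[/and3P[_ /eqP<- _] /and3P[_ /eqP<- _]].
have fa : 0 < f a.
  by rewrite lt0n; apply: contraNneq ab => fa; rewrite (f0 a b) // -fab.
exists (f a); first by rewrite mv; case: (fcl a Sa); lia.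
by rewrite !me Sa Sb -fab eqxx fa.
Qed.

(** Here [a] is the root of A, the smallest child of k. If k is a leaf, no vertex meets the test
    [f v == k], and any value of [a] gives the same function. *)
Definition rearrange_par (k a : nat) (f : nat -> nat) (v : nat) : nat :=
  if v == k then k.-1
  else if f v == k then (if v == a then f k.-1 else k.-1) else f v.

Lemma rearrange_represents S f k T :
  represents S f T -> ptree S f -> 1 < k -> S k -> S k.-1 -> f k = f k.-1 ->
  represents S (rearrange_par k (head 0 (children T k)) f) (rearrange k T).
Proof.
move=> fT fS k1 Sk Sk1 fk.
have [mv Sr fr me] := fT; have [_ flt fcl f0 _] := fS.
have kk1 := flt _ Sk1; have kk := flt _ Sk.
have fk0 : 0 < f k.-1.
  rewrite lt0n; apply/eqP => e; have := f0 k k.-1; rewrite fk.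
  by move=> /(_ Sk Sk1 e e); lia.
split=> //=.
  rewrite /rearrange_par fr; have [e|_] := eqVneq (root T) k.
    rewrite e in fr; lia.
  by have -> : (0 == k) = false by lia.
move=> u v; rewrite (parent_rep fT fS) // !inE /= me xpair_eqE /rearrange_par.
have := mem_children fT k; have := size_children fT fS k.
have := children_sorted T k; case: (children T k) => [|a [|b [|//]]] /= so _ mc.
- have nch : S v && (f v == k) = false by have := mc v; rewrite in_nil; lia.
  rewrite inE xpair_eqE; have [->|vk] := eqVneq v k; first by rewrite Sk fk /=; lia.
  by case Sv: (S v) nch => /= nch; rewrite ?nch; lia.
- have := mc v; have := mc a; rewrite !inE !xpair_eqE eqxx => /esym/and3P[Sa /eqP fa _].
  have [->|vk] := eqVneq v k.
    have -> : (k == a) = false by apply/eqP => e; have := flt a Sa; lia.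
    by rewrite Sk fk /=; lia.
  have [->|va] := eqVneq v a; first by rewrite Sa fa eqxx /=; lia.
  by case Sv: (S v) => /= e; case: (eqVneq (f v) k) e => [fv|fv] /= e; rewrite ?fv; lia.
have := mc v; have := mc b; have := mc a; rewrite !inE !xpair_eqE !eqxx orbT /=.
move=> /esym/and3P[Sa /eqP fa _] /esym/and3P[Sb /eqP fb _].
have fa' := flt _ Sa; have fb' := flt _ Sb.
have [->|vk] := eqVneq v k.
  have -> : (k == a) = false by lia.
  have -> : (k == b) = false by lia.
  by rewrite Sk fk /=; lia.
have [->|va] := eqVneq v a.
  have -> : (a == b) = false by lia.
  by rewrite Sa fa eqxx /=; lia.
have [->|vb] := eqVneq v b; first by rewrite Sb fb eqxx /=; lia.
by case Sv: (S v) => /= e; case: (eqVneq (f v) k) e => [fv|fv] /= e; rewrite ?fv; lia.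
Qed.

(** * Label sets, and case (b2): exchanging k-1 and k *)

Definition box (n : nat) : pred nat := fun v => 0 < v <= n.

Definition hole (n k : nat) : pred nat :=
  fun v => [&& 0 < v, v <= n, v != k & v != k.-1].

Lemma swap_cases k x :
  x = k /\ swap k x = k.-1 \/ x = k.-1 /\ swap k x = k
  \/ x <> k /\ x <> k.-1 /\ swap k x = x.
Proof.
rewrite /swap /=; have [|/eqP xk] := eqVneq x k; first by left.
by have [|/eqP xk1] := eqVneq x k.-1; right; [left | right].
Qed.

Lemma swapK k : involutive (swap k).
Proof.
by move=> x; have := swap_cases k x; have := swap_cases k (swap k x); lia.
Qed.

Section Swap.
Variables (n k : nat) (f : nat -> nat).
Hypotheses (k1 : 1 < k) (kn : k <= n) (fS : ptree (box n) f).

Lemma swap0 : swap k 0 = 0.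
Proof. by have := swap_cases k 0; lia. Qed.

Lemma swap_bij : label_bij (swap k) (swap k) (box n) (box n).
Proof.
have sw x : box n x -> box n (swap k x).
  by have := swap_cases k x; rewrite /box; lia.
by split; rewrite ?swap0 // => x Sx; rewrite swapK; split=> //; apply: sw.
Qed.

(** The exchange reverses the order of the pair k-1, k only. This pair is not an edge, as k-1 is a
    leaf, so the tree stays increasing; it is not a pair of siblings, so the smallest children on
    the chain stay smallest. *)
Lemma swap_up (f' := fun v => swap k (f (swap k v))) :
  leaf_end (box n) f k.-1 -> f k != f k.-1 ->
  [/\ ptree (box n) f', leaf_end (box n) f' k & f' k != k.-1].
Proof.
rewrite /f' => -[Sk1 Ck1 leaf] fk; have [_ flt _ _ _] := fS.
have lt1 := flt k.-1 Sk1.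
have swk : swap k k.-1 = k by have := swap_cases k k.-1; lia.
have swk' : swap k k = k.-1 by have := swap_cases k k; lia.
have swlt x : x < k.-1 -> swap k x = x by have := swap_cases k x; lia.
split; first (apply: (ptree_relabel swap_bij) => // v Sv).
- have := leaf v Sv; have := flt v Sv.
  have [vk|] := eqVneq v k; last first.
    by have := swap_cases k v; have := swap_cases k (f v); lia.
  by rewrite vk swk' => ? ?; rewrite swlt; lia.
- split; first by rewrite /box; lia.
    suff: on_chain (box n) f' (swap k k.-1) by rewrite swk.
    apply: on_chain_map Ck1 => //; first exact: swap0.
    move=> w wk1 _ [Sw mw]; rewrite /f' swapK; split=> //; split.
      by case: swap_bij => _ _ /(_ w Sw)[].
    move=> x Sx; rewrite swapK => /(can_inj (swapK k)) fx.
    have Sx' : box n (swap k x) by case: swap_bij => _ _ /(_ x Sx)[].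
    have := mw _ Sx' fx; have := swap_cases k x; have := swap_cases k w.
    have [e|] := eqVneq w k.-1; last by lia.
    have [e'|] := eqVneq x k.-1; last by lia.
    by move: fx fk; rewrite e e' swk => ->; rewrite eqxx.
  move=> w Sw; have Sw' : box n (swap k w) by case: swap_bij => _ _ /(_ w Sw)[].
  by have := leaf _ Sw'; have := swap_cases k (f (swap k w)); lia.
by rewrite swk' swlt; lia.
Qed.

(** Again k-1 and k form no edge. They are no siblings either: k is the smallest child of its
    parent, which leaves no room for k-1. *)
Lemma swap_down (f' := fun v => swap k (f (swap k v))) :
  leaf_end (box n) f k -> f k != k.-1 ->
  [/\ ptree (box n) f', leaf_end (box n) f' k.-1 & f' k != f' k.-1].
Proof.
rewrite /f' => -[Sk Ck leaf] fk; have [_ flt _ f0 _] := fS.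
have ltk := flt k Sk; have k0 : 0 < k by lia.
have [_ _ [_ mk]] := on_chain_inv Ck k0.
have Sk1 : box n k.-1 by rewrite /box; lia.
have lt1 := flt k.-1 Sk1.
have swk : swap k k.-1 = k by have := swap_cases k k.-1; lia.
have swk' : swap k k = k.-1 by have := swap_cases k k; lia.
have swlt x : x < k.-1 -> swap k x = x by have := swap_cases k x; lia.
split; first (apply: (ptree_relabel swap_bij) => // v Sv).
- have := leaf v Sv; have := flt v Sv.
  have [vk|] := eqVneq v k; last first.
    by have := swap_cases k v; have := swap_cases k (f v); lia.
  by rewrite vk swk' => ? ?; rewrite swlt; lia.
- split; first by rewrite /box; lia.
    suff: on_chain (box n) f' (swap k k) by rewrite swk'.
    apply: (on_chain_map _ _ _ Ck) => //; first exact: swap0.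
    move=> w wk Cw [Sw mw]; rewrite /f' swapK; split=> //; split.
      by case: swap_bij => _ _ /(_ w Sw)[].
    move=> x Sx; rewrite swapK => /(can_inj (swapK k)) fx.
    have Sx' : box n (swap k x) by case: swap_bij => _ _ /(_ x Sx)[].
    have := mw _ Sx' fx; have := swap_cases k x; have := swap_cases k w.
    (* Were k-1 on the chain, the next chain vertex would be above k-1 and at most k, so k would be
       a child of k-1. *)
    suff : w <> k.-1 by lia.
    move=> e; rewrite e in Cw; have lek : k.-1 < k by lia.
    have [c [Sc _ _ fc ck]] := on_chain_step fS Sk1 Cw Ck lek.
    have ck' : c = k by have := flt c Sc; lia.
    by rewrite -fc ck' eqxx in fk.
  move=> w Sw; have Sw' : box n (swap k w) by case: swap_bij => _ _ /(_ w Sw)[].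
  by have := leaf _ Sw'; have := swap_cases k (f (swap k w)); lia.
rewrite swk' swk; have := mk _ Sk1.
by have := swap_cases k (f k); have := swap_cases k (f k.-1); lia.
Qed.

End Swap.

(* The trees produced by case (a), for leaf_end (box n) f k. *)
Definition inserted_pair (n k : nat) (f : nat -> nat) : Prop :=
  f k = k.-1 /\ exists m, [/\ box n m, m <> k, f m = k.-1 &
    forall s, box n s -> s <> k.-1 -> f s = f k.-1 -> m < s].

(** * Case (b1): rearranging siblings k-1 and k *)

(** Inverse of (b1), with j = [f k.-1]: the other child of j is the root of A and the other child of
    k-1 is the root of B, and both return to k. Which of them is smaller need not be known. *)
Definition unrearrange_par (k : nat) (f : nat -> nat) (v : nat) : nat :=
  if v == k then f k.-1
  else if (f v == k.-1) || ((f v == f k.-1) && (v != k.-1)) then k else f v.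

(** Case table in the form that [lia] can exploit. *)
Lemma rearrange_par_cases k a f v (f' := rearrange_par k a f) :
  v = k /\ f' v = k.-1
  \/ v <> k /\ f v = k /\ v = a /\ f' v = f k.-1
  \/ v <> k /\ f v = k /\ v <> a /\ f' v = k.-1
  \/ v <> k /\ f v <> k /\ f' v = f v.
Proof.
rewrite /f' /rearrange_par; do 3?case: eqP => ? //; tauto.
Qed.

Lemma unrearrange_par_cases k f v (f' := unrearrange_par k f) :
  v = k /\ f' v = f k.-1
  \/ v <> k /\ f v = k.-1 /\ f' v = k
  \/ v <> k /\ v <> k.-1 /\ f v <> k.-1 /\ f v = f k.-1 /\ f' v = k
  \/ v <> k /\ f v <> k.-1 /\ (v = k.-1 \/ f v <> f k.-1) /\ f' v = f v.
Proof.
rewrite /f' /unrearrange_par; do 4?[case: eqP => ? //=]; tauto.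
Qed.

Section Rearrange.
Variables (n k : nat) (f : nat -> nat).
Hypotheses (k1 : 1 < k) (kn : k <= n) (fS : ptree (box n) f).

(** The hypothesis on [a] says that it is the smallest child of k as soon as k has one. Below k-1
    the chain is untouched, and it is extended by the new leaf k, the smallest child of k-1. *)
Lemma rearrange_par_up a (f' := rearrange_par k a f) :
  leaf_end (box n) f k.-1 -> f k = f k.-1 ->
  (forall v, box n v -> f v = k -> [/\ box n a, f a = k & a <= v]) ->
  [/\ ptree (box n) f', leaf_end (box n) f' k, f' k = k.-1,
      ~ inserted_pair n k f'
    & forall v, box n v -> unrearrange_par k f' v = f v].
Proof.
move=> [Sk1 Ck1 leaf] fk amin; have [[r Sr fr] flt fcl f0 f3] := fS.
have Sk : box n k by rewrite /box; lia.
have kk1 := flt _ Sk1; have kk := flt _ Sk.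
have k0 : 0 < k.-1 by lia.
have [_ _ [_ mk]] := on_chain_inv Ck1 k0.
have fk0 : 0 < f k.-1 by rewrite lt0n; apply/eqP => e; have := f0 k k.-1 Sk Sk1; lia.
have c v := rearrange_par_cases k a f v; rewrite -/f' in c.
have ck := c k; have ck1 := c k.-1.
have f'k1 : f' k.-1 = f k.-1 by lia.
have f'k : f' k = k.-1 by lia.
have flt' v : box n v -> f' v < v.
  by move=> Sv; have := c v; have := flt v Sv; lia.
split=> //.
- split=> //.
  + exists r => //; suff : r <> k by have := c r; lia.
    by move=> e; rewrite e in fr; lia.
  + move=> v Sv; have := c v; have := fcl v Sv; have := fcl k.-1 Sk1.
    by move: Sk1; rewrite /box; lia.
  + move=> u v Su Sv; have := c u; have := c v; have := f0 u v Su Sv; lia.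
  + have cj x : box n x -> f' x = f k.-1 -> x = k.-1 \/ x = a.
      move=> Sx; have := f3 k.-1 k x Sk1 Sk Sx; have := c x; lia.
    have ck' x : box n x -> f' x = k.-1 -> x = k \/ f x = k /\ x <> a.
      move=> Sx; have := leaf x Sx; have := c x; lia.
    have co x : f' x <> f k.-1 -> f' x <> k.-1 -> f' x = f x.
      by have := c x; lia.
    move=> x y z Sx Sy Sz xy yz.
    have [e|nj] := eqVneq (f' x) (f k.-1).
      by have := cj x Sx; have := cj y Sy; have := cj z Sz; lia.
    have [e|nk] := eqVneq (f' x) k.-1.
      (* [a] takes one of the two places below k, so at most one other child of k moves to k-1. *)
      have f3a u v : box n u -> box n v -> f u = k /\ u <> a ->
          f v = k /\ v <> a -> u = v.
        move=> Su Sv [fu ua] [fv va]; have [Sa fa _] := amin u Su fu.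
        by case: (f3 a u v Sa Su Sv) => [||h|[h|h]]; congruence.
      have ey : f' y = k.-1 by rewrite -xy.
      have ez : f' z = k.-1 by rewrite -yz.
      case: (ck' x Sx e) => X; case: (ck' y Sy ey) => Y; case: (ck' z Sz ez) => Z;
        first [by left; congruence | by right; left; congruence
             | by right; right; congruence | by left; apply: f3a
             | by right; left; apply: f3a | by right; right; apply: f3a].
    have ex : f' x = f x by apply: co; apply/eqP.
    have ey : f' y = f y by apply: co; rewrite -xy; apply/eqP.
    have ez : f' z = f z by apply: co; rewrite -yz -xy; apply/eqP.
    by apply: f3; rewrite // -?ex -?ey -?ez.
- split=> //.
    apply: on_chainS; last first.
      split=> // w Sw; rewrite f'k => f'w; have := c w; have := leaf w Sw.
      by have := flt w Sw; lia.
    rewrite f'k; apply: (@on_chain_map id (box n) f) => // w wk1 _ [Sw mw].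
    have ew : f' w = f w by have := c w; have := flt w Sw; lia.
    split=> //; split=> // x Sx; rewrite ew => f'x.
    by have := c x; have := mw x Sx; have := flt x Sx; lia.
  move=> w Sw; have := c w; have := flt k.-1 Sk1; lia.
(* A child m of k-1 other than k came from k, so a <= m; but a is now a sibling of k-1, and an
   inserted pair would require m < a. *)
- case=> _ [m [Sm mk' f'm]]; have cm := c m; have lm := leaf m Sm.
  have [Sa fa am] : [/\ box n a, f a = k & a <= m] by apply: amin; lia.
  have ca := c a; have := flt a Sa.
  by move=> ? /(_ a Sa); lia.
move=> v Sv; have := unrearrange_par_cases k f' v.
have [->|vk] := eqVneq v k; first by lia.
have [->|vk1] := eqVneq v k.-1; first by lia.
(* k-1 and k filled both places below their parent, so the only other vertex below it after the move
   is [a], which rightly returns to k. *)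
have nj : f v <> f k.-1 by have := f3 k.-1 k v Sk1 Sk Sv; lia.
by have := c v; have := leaf v Sv; lia.
Qed.

(** The failure of [inserted_pair] ensures that the smallest child of k after the undoing is the
    former sibling of k-1, so that (b1) sends the right vertex back to j. *)
Lemma rearrange_par_down (f' := unrearrange_par k f) :
  2 < n -> leaf_end (box n) f k -> f k = k.-1 -> ~ inserted_pair n k f ->
  [/\ ptree (box n) f', leaf_end (box n) f' k.-1, f' k = f' k.-1
    & forall a, (forall v, box n v -> f' v = k -> [/\ box n a, f' a = k & a <= v]) ->
      forall v, box n v -> rearrange_par k a f' v = f v].
Proof.
move=> n2 [Sk Ck leaf] fk npair; have [[r Sr fr] flt fcl f0 f3] := fS.
have Sk1 : box n k.-1 by rewrite /box; lia.
have kk1 := flt _ Sk1.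
have [k0 k10] : 0 < k /\ 0 < k.-1 by lia.
have [_ Ck1 _] := on_chain_inv Ck k0; rewrite fk in Ck1.
have [_ Cj [_ mk1]] := on_chain_inv Ck1 k10.
(* If k-1 were the root, then k = 2, and the vertex 3, which exists as n > 2, could only be a child
   of 1. As the root has no sibling, the pair would be inserted. *)
have j0 : 0 < f k.-1.
  rewrite lt0n; apply/eqP => j0.
  have S1 : box n 1 by rewrite /box; lia.
  have S3 : box n 3 by rewrite /box; lia.
  have k2 : k.-1 = 1 by apply: f0 => //; have := flt 1 S1; lia.
  have f3' : f 3 = k.-1.
    have := leaf 3 S3; have := f0 3 k.-1 S3 Sk1; have := flt 3 S3; lia.
  apply: npair; split=> //; exists 3; split=> // [|s Ss sk1]; first by lia.
  by rewrite j0 => fs; have := f0 s k.-1 Ss Sk1 fs j0.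
(* Any child of k-1 other than k is matched by a sibling of k-1 that does not exceed it. *)
have pair m : box n m -> m <> k -> f m = k.-1 ->
    exists s, [/\ box n s, s <> k.-1, f s = f k.-1 & s <= m].
  move=> Sm mk fm; apply: contrapT => no; apply: npair; split=> //.
  exists m; split=> // s Ss sk1 fs; rewrite ltnNge; apply/negP => sm.
  by apply: no; exists s.
have c v := unrearrange_par_cases k f v; rewrite -/f' in c.
have f'k : f' k = f k.-1 by have := c k; lia.
have f'k1 : f' k.-1 = f k.-1 by have := c k.-1; lia.
have kclass x : box n x -> f' x = k ->
    x <> k /\ (f x = k.-1 \/ f x = f k.-1 /\ x <> k.-1).
  move=> Sx f'x; have := leaf x Sx.
  by case: (c x) => [|[|[|]]]; [lia | lia | tauto | lia].
have jclass x : f' x = f k.-1 -> x = k \/ x = k.-1 by have := c x; lia.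
have oclass x : f' x <> k -> x <> k -> f' x = f x by have := c x; lia.
have ju x y : box n x -> box n y -> f x = f k.-1 /\ x <> k.-1 ->
    f y = f k.-1 /\ y <> k.-1 -> x = y.
  move=> Sx Sy [fx xk] [fy yk].
  have [] : x = y \/ y = k.-1 \/ x = k.-1 by apply: f3 => //; congruence.
    by [].
  by case.
have ku x y : box n x -> box n y -> x <> k -> y <> k -> f x = k.-1 ->
    f y = k.-1 -> x = y.
  move=> Sx Sy xk yk fx fy.
  have [] : x = y \/ y = k \/ x = k by apply: f3 => //; congruence.
    by [].
  by case.
have kin s : f s = f k.-1 -> s <> k.-1 -> f' s = k.
  move=> fs sk1; have sk : s <> k by move=> e; rewrite e in fs; lia.
  by have := c s; lia.
(* k-1 is on the chain, so its siblings exceed k-1, hence k, and may be hung below k. *)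
have flt' v : box n v -> f' v < v.
  move=> Sv; have [->|/eqP vk] := eqVneq v k; first by lia.
  have := flt v Sv; have := mk1 v Sv; have := c v; lia.
split=> //; last 2 first.
- by rewrite f'k f'k1.
- move=> a amin v Sv; case: (rearrange_par_cases k a f' v) => [[-> ->] //|].
  case=> [[vk [e [va ->]]]|[[vk [e [va ->]]]|[vk [e ->]]]].
  + rewrite f'k1; have [_ [fv|[-> _]//]] := kclass v Sv e.
    have [s [Ss sk1 fs sv]] := pair v Sv vk fv.
    have [_ _ vs] := amin s Ss (kin s fs sk1); rewrite -va in vs.
    have vs' : v = s by apply/eqP; rewrite eqn_leq vs sv.
    by rewrite vs' fs.
  + have [_ [//|fv]] := kclass v Sv e; have [Sa fa av] := amin v Sv e.
    case: va; have [ak [fa'|fa']] := kclass a Sa fa; last exact: ju.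
    have [s [Ss sk1 fs sa]] := pair a Sa ak fa'.
    have vs : v = s by apply: ju.
    by apply/eqP; rewrite eqn_leq av vs sa.
  + exact: oclass.
- split.
  + exists r => //; rewrite oclass // => [e|e]; last by rewrite e in fr; lia.
    by have [_ [|[]]] := kclass r Sr e; lia.
  + exact: flt'.
  + move=> v Sv; have := c v; have := fcl v Sv; have := fcl k.-1 Sk1.
    by move: Sk; rewrite /box; clear -k1; lia.
  + have z u : box n u -> f' u = 0 -> f u = 0.
      by move=> Su f'u; rewrite -oclass // => e; [lia | rewrite e in f'u; lia].
    by move=> u v Su Sv fu fv; apply: f0 => //; apply: z.
  + move=> x y z Sx Sy Sz xy yz.
    have [e|/eqP nk] := eqVneq (f' x) k.
      have [xk X] := kclass x Sx e.
      have [|yk Y] := kclass y Sy; first congruence.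
      have [|zk Z] := kclass z Sz; first congruence.
      (* Each of the three is a former child or a former sibling of k-1. Two are of the same kind,
         and each kind has one member besides k and k-1. *)
      by case: X => X; case: Y => Y; case: Z => Z;
        first [by left; apply: ju | by left; apply: ku
             | by right; left; apply: ju | by right; left; apply: ku
             | by right; right; apply: ju | by right; right; apply: ku].
    have [e|/eqP nj] := eqVneq (f' x) (f k.-1).
      have X := jclass x e.
      have Y : y = k \/ y = k.-1 by apply: jclass; congruence.
      have Z : z = k \/ z = k.-1 by apply: jclass; congruence.
      by lia.
    have ok w : f' w = f' x -> f' w = f w.
      by move=> e; apply: oclass; [congruence | move=> ek; rewrite ek in e; congruence].
    have ex : f' x = f x by apply: ok.
    have ey : f' y = f y by apply: ok.
    have ez : f' z = f z by apply: ok; rewrite -yz.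
    by apply: f3; rewrite // -?ex -?ey -?ez.
- split=> //; last first.
    by move=> w Sw; have := c w; have := flt w Sw; lia.
  suff: on_chain (box n) f' (id k.-1) by [].
  apply: (@on_chain_map id (box n) f) => // w wk1 _ [Sw mw].
  have ew : f' w = f w.
    by have := mk1 w Sw; have := flt w Sw; have := c w; lia.
  split=> //; split=> // x Sx; rewrite ew => f'x.
  by have := mw x Sx; have := flt w Sw; have := c x; lia.
Qed.

End Rearrange.

(** * Case (a): inserting the pair k-1, k *)

Definition uninsert_par (k m : nat) (f : nat -> nat) (v : nat) : nat :=
  if v == m then f k.-1 else f v.

Section Insert.
Variables (n k m : nat) (f : nat -> nat).
Hypotheses (k1 : 1 < k) (kn : k <= n).

Lemma insert_par_up (f' := insert_par k m f) :
  ptree (hole n k) f -> on_chain (hole n k) f m -> f m < k < m ->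
  [/\ ptree (box n) f', leaf_end (box n) f' k, inserted_pair n k f',
      forall v, box n v -> v <> k -> f' v = k.-1 -> v = m
    & forall v, hole n k v -> uninsert_par k m f' v = f v].
Proof.
move=> fS Cm /andP[fmk km]; have [[r Sr fr] flt fcl f0 f3] := fS.
have m0 : 0 < m by lia.
have [Sm Cj [_ mm]] := on_chain_inv Cm m0.
have Sk : box n k by rewrite /box; lia.
have Sk1 : box n k.-1 by rewrite /box; lia.
have fval v : hole n k v -> f v <> k /\ f v <> k.-1.
  by move=> Sv; have := fcl v Sv; rewrite /hole; lia.
have bh v : box n v -> v <> k -> v <> k.-1 -> hole n k v.
  by rewrite /box /hole; lia.
have hb v : hole n k v -> [/\ box n v, v <> k & v <> k.-1].
  by rewrite /box /hole; split; lia.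
have f'm : f' m = k.-1 by rewrite /f' /insert_par eqxx.
have f'k : f' k = k.-1 by rewrite /f' /insert_par eqxx orbT.
have f'k1 : f' k.-1 = f m.
  by rewrite /f' /insert_par eqxx; case: ifP => //; lia.
have f'o v : v <> m -> v <> k -> v <> k.-1 -> f' v = f v.
  by rewrite /f' /insert_par; do 3?case: eqP.
have [fmk1 _] : f m <> k.-1 /\ f m <> k by have := fval m Sm; lia.
have cases v : [\/ v = m, v = k, v = k.-1
    | [/\ v <> m, v <> k, v <> k.-1 & f' v = f v]].
  have [|/eqP vm] := eqVneq v m; first by constructor.
  have [|/eqP vk] := eqVneq v k; first by constructor.
  have [|/eqP vk1] := eqVneq v k.-1; first by constructor.
  by constructor 4; split=> //; apply: f'o.
have child v : box n v -> f' v = k.-1 -> v = m \/ v = k.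
  move=> Sv; case: (cases v) => [||->|[_ vk vk1 ->] fv]; auto.
    by rewrite f'k1.
  by have [_] := fval v (bh v Sv vk vk1).
(* k-1 takes over the place of m: apart from the children m and k of k-1, every vertex v has as new
   parent the old parent of [psi v], and [psi] is injective there. The tree axioms are pulled back
   along it. *)
pose psi v := if v == k.-1 then m else v.
have psiP v : box n v -> f' v <> k.-1 -> hole n k (psi v) /\ f' v = f (psi v).
  rewrite /psi => Sv; case: eqP => [-> _|vk1].
    by rewrite f'k1.
  by case: (cases v) => [->|->|//|[vm vk _ ->] _] //; split=> //; apply: bh.
have psi_inj u v : f' u <> k.-1 -> f' v <> k.-1 -> psi u = psi v -> u = v.
  have no_m w : f' w <> k.-1 -> w <> m by move=> nw e; case: nw; rewrite e.
  move=> /no_m um /no_m vm; rewrite /psi.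
  by case: eqP => [->|_]; case: eqP => [->|_] // e; case: vm.
split.
- split.
  + have [e|/eqP rm] := eqVneq r m; first by exists k.-1; rewrite // f'k1 -e.
    by have [Sr' rk rk1] := hb r Sr; exists r => //; rewrite f'o.
  + move=> v Sv; case: (cases v) => [->|->|->|[_ vk vk1 ->]]; try lia.
    by apply/flt/bh.
  + move=> v Sv; have [->|/eqP nk] := eqVneq (f' v) k.-1; first by right.
    have [Sp ->] := psiP v Sv nk; case: (fcl _ Sp) => [|/hb[]]; by [left | right].
  + move=> u v Su Sv fu fv.
    have nu : f' u <> k.-1 by lia.
    have nv : f' v <> k.-1 by lia.
    apply: psi_inj => //; have [Hu eu] := psiP u Su nu; have [Hv ev] := psiP v Sv nv.
    by apply: f0; rewrite // -?eu -?ev.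
  + move=> x y z Sx Sy Sz xy yz.
    have [e|/eqP nx] := eqVneq (f' x) k.-1.
      have X := child x Sx e.
      have Y : y = m \/ y = k by apply: child; congruence.
      have Z : z = m \/ z = k by apply: child; congruence.
      by clear -X Y Z; lia.
    have ny : f' y <> k.-1 by congruence.
    have nz : f' z <> k.-1 by congruence.
    have [Hx ex] := psiP x Sx nx; have [Hy ey] := psiP y Sy ny.
    have [Hz ez] := psiP z Sz nz.
    have := f3 _ _ _ Hx Hy Hz; rewrite -ex -ey -ez => /(_ xy yz).
    case=> [e|[e|e]]; [left | right; left | right; right]; exact: psi_inj e.
- split=> //.
    apply: on_chainS; last first.
      split=> // w Sw; rewrite f'k => /(child w Sw); lia.
    rewrite f'k; apply: on_chainS; last first.
      split=> // w Sw; rewrite f'k1.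
      case: (cases w) => [->|->|->|[wm wk wk1 -> fw]]; try lia.
      by have := mm w (bh w Sw wk wk1) fw; lia.
    rewrite f'k1; suff: on_chain (box n) f' (id (f m)) by [].
    apply: (@on_chain_map id (hole n k) f) => // w wm _ [Sw mw].
    have [Sw' wk wk1] := hb w Sw.
    rewrite f'o //; last by lia.
    split=> //; split=> // x Sx.
    case: (cases x) => [->|->|->|[xm xk xk1 -> fx]]; try lia.
    by apply: mw; [apply: bh | rewrite fx f'o // => e; lia].
  move=> w Sw; case: (cases w) => [->|->|->|[xm xk xk1 ->]]; try lia.
  by have [] := fval w (bh w Sw xk xk1).
- split=> //; exists m; split=> //; [by have [] := hb m Sm | by lia |].
  move=> s Ss sk1; rewrite f'k1.
  case: (cases s) => [->|->|//|[sm sk sk2 -> fs]]; try lia.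
  by have := mm s (bh s Ss sk sk1) fs; lia.
- by move=> v Sv vk /(child v Sv)[].
move=> v Sv; rewrite /uninsert_par; case: eqP => [->|vm]; first by rewrite f'k1.
by have [_ vk vk1] := hb v Sv; apply: f'o.
Qed.

(** Contracting k-1 onto m gives m the siblings of k-1. They all exceed m, so m is a smallest child
    and stays on the chain. *)
Lemma insert_par_down (f' := uninsert_par k m f) :
  ptree (box n) f -> leaf_end (box n) f k -> f k = k.-1 -> box n m -> m <> k ->
  f m = k.-1 -> (forall s, box n s -> s <> k.-1 -> f s = f k.-1 -> m < s) ->
  [/\ ptree (hole n k) f', on_chain (hole n k) f' m, f' m < k < m
    & forall v, box n v -> insert_par k m f' v = f v].
Proof.
move=> fS [Sk Ck leaf] fk Sm mk fm sib; have [[r Sr fr] flt fcl f0 f3] := fS.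
have Sk1 : box n k.-1 by rewrite /box; lia.
have kk1 := flt _ Sk1.
have [k0 k10] : 0 < k /\ 0 < k.-1 by lia.
have [_ Ck1 _] := on_chain_inv Ck k0; rewrite fk in Ck1.
have [_ Cj [_ mk1]] := on_chain_inv Ck1 k10.
have km : k < m by have := flt m Sm; lia.
have bh v : box n v -> v <> k -> v <> k.-1 -> hole n k v.
  by rewrite /box /hole; lia.
have hb v : hole n k v -> [/\ box n v, v <> k & v <> k.-1].
  by rewrite /box /hole; split; lia.
have f'm : f' m = f k.-1 by rewrite /f' /uninsert_par eqxx.
have f'o v : v <> m -> f' v = f v by rewrite /f' /uninsert_par; case: eqP.
pose psi v := if v == m then k.-1 else v.
have psiE v : f' v = f (psi v) by rewrite /f' /uninsert_par /psi; case: eqP.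
have psiS v : hole n k v -> box n (psi v).
  by rewrite /psi; case: eqP => // _ /hb[].
have psi_inj u v : hole n k u -> hole n k v -> psi u = psi v -> u = v.
  move=> /hb[_ _ uk] /hb[_ _ vk]; rewrite /psi.
  by case: eqP => [->|_]; case: eqP => [->|_] // e; case: vk.
have Hm : hole n k m by apply: bh => //; lia.
split.
- split.
  + have [e|/eqP rk] := eqVneq r k.-1; first by exists m; rewrite // f'm -e.
    have rm : r <> m by move=> e; rewrite e in fr; lia.
    have rk' : r <> k by move=> e; rewrite e in fr; lia.
    by exists r; [apply: bh | rewrite f'o].
  + move=> v Sv; have [Sv' vk vk1] := hb v Sv.
    have [->|/eqP vm] := eqVneq v m; first by rewrite f'm; lia.
    by rewrite f'o //; apply: flt.
  + move=> v Sv; have [Sv' vk vk1] := hb v Sv.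
    have [->|/eqP vm] := eqVneq v m.
      rewrite f'm; case: (fcl _ Sk1) => [|Sj]; [by left | right].
      by apply: bh => //; lia.
    rewrite f'o //; case: (fcl v Sv') => [|Sj]; [by left | right].
    apply: bh => //; first exact: leaf.
    move=> fv; have : v = k \/ k = m \/ v = m by apply: f3; congruence.
    by case=> [|[]]; congruence.
  + move=> u v Su Sv; rewrite !psiE => fu fv; apply: psi_inj => //.
    by apply: f0 => //; apply: psiS.
  + move=> x y z Sx Sy Sz; rewrite !psiE => xy yz.
    have := f3 _ _ _ (psiS x Sx) (psiS y Sy) (psiS z Sz) xy yz.
    case=> [e|[e|e]]; [left | right; left | right; right]; exact: psi_inj e.
- apply: on_chainS; last first.
    split=> // w Sw; rewrite f'm; have [-> //|/eqP wm] := eqVneq w m.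
    rewrite f'o // => fw; have [Sw' wk wk1] := hb w Sw.
    by apply/ltnW/sib.
  rewrite f'm; suff: on_chain (hole n k) f' (id (f k.-1)) by [].
  apply: (@on_chain_map id (box n) f) => // w wj _ [Sw mw].
  rewrite f'o //; last by lia.
  split=> //; split=> [|x Sx]; first by apply: bh => //; lia.
  have [-> _|/eqP xm] := eqVneq x m; first by lia.
  rewrite !f'o //= => [fx|e]; last by rewrite /= in e; lia.
  by apply: mw => //; have [] := hb x Sx.
- by rewrite f'm km andbT; lia.
move=> v Sv; rewrite /insert_par; have [->|/eqP vm] := eqVneq v m; first by [].
have [->|/eqP vk] := eqVneq v k; first by rewrite fk.
have [->|/eqP vk1] := eqVneq v k.-1; first by [].
by rewrite /= f'o.
Qed.

End Insert.

(** * Case (b) as an operation on trees *)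

Section Trees.
Variable n : nat.

Lemma mem_iota_box v : (v \in [fset x in iota 1 n]%fset) = box n v.
Proof. by rewrite !inE mem_iota /box; lia. Qed.

Lemma trees_represents T : trees n T ->
  represents (box n) (parent T) T /\ ptree (box n) (parent T).
Proof. exact: (tree012_represents mem_iota_box). Qed.

Lemma trees_end_represents k T : trees_end n k T ->
  [/\ represents (box n) (parent T) T, ptree (box n) (parent T)
    & leaf_end (box n) (parent T) k].
Proof.
by case=> /trees_represents[fT fS] <-; split=> //; apply: leaf_end_chain_end fT fS.
Qed.

Lemma represents_trees_end k f T : represents (box n) f T -> ptree (box n) f ->
  leaf_end (box n) f k -> trees_end n k T.
Proof.
move=> fT fS fk; split; first exact: represents_tree012 fT fS _ mem_iota_box.
exact/(chain_endP fT fS).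
Qed.

Lemma parent_inj T T' : trees n T -> trees n T' ->
  (forall v, box n v -> parent T v = parent T' v) -> T = T'.
Proof.
move=> /trees_represents[fT fS] /trees_represents[fT' fS'] e.
by apply: (represents_inj fT _ fS); apply: (represents_eq fT') => v /e.
Qed.

Lemma trees_end_exists k f : ptree (box n) f -> leaf_end (box n) f k ->
  exists2 T, trees_end n k T & forall v, box n v -> parent T v = f v.
Proof.
move=> fS fk; have fT : represents (box n) f (tree_of (iota 1 n) f).
  by apply: tree_of_represents => // v; rewrite mem_iota /box; lia.
exists (tree_of (iota 1 n) f); first exact: represents_trees_end fT fS fk.
by move=> v; apply: parent_rep.
Qed.

(** A child k of k-1 is the trace of (b1), since (b2) puts k below a vertex less than k-1. *)
Definition unshift_par (k : nat) (f : nat -> nat) (v : nat) : nat :=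
  if f k == k.-1 then unrearrange_par k f v else swap k (f (swap k v)).

Section Shift.
Variable k : nat.
Hypotheses (k1 : 1 < k) (kn : k <= n).

Lemma box_k : box n k /\ box n k.-1. Proof. by rewrite /box; split; lia. Qed.

Lemma eq_unshift_par f g v : box n v -> (forall x, box n x -> f x = g x) ->
  unshift_par k f v = unshift_par k g v.
Proof.
move=> Sv fg; have [Sk Sk1] := box_k; have [_ _ /(_ v Sv)[Sw _] _] := swap_bij k1 kn.
by rewrite /unshift_par /unrearrange_par !fg.
Qed.

Lemma children_head_min S f T v : represents S f T -> ptree S f -> S v -> f v = k ->
  let a := head 0 (children T k) in [/\ S a, f a = k & a <= v].
Proof.
move=> fT fS Sv fv; have : v \in children T k.
  by rewrite (mem_children fT) Sv fv eqxx; lia.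
case ch: (children T k) => [//|c s] _.
have [|Sc fc mc] := children_head fT (v := k); first by rewrite ch.
rewrite ch /= in Sc fc mc *; split=> //; case: mc => _; apply=> //.
by rewrite fv fc.
Qed.

(** The last clause is a left inverse, whence injectivity; the second keeps the image apart from
    that of (a). *)
Lemma shift_end_trees_end T : trees_end n k.-1 T ->
  [/\ trees_end n k (shift_end k T), ~ inserted_pair n k (parent (shift_end k T))
    & forall v, box n v -> unshift_par k (parent (shift_end k T)) v = parent T v].
Proof.
case/trees_end_represents => fT fS fk; have [Sk Sk1] := box_k.
(* The claims are proved for an explicit parent function, then carried over to [parent], which
   agrees with it on the labels. *)
suff [f [fT' fS' fk' np fu]] : exists f,
    [/\ represents (box n) f (shift_end k T), ptree (box n) f, leaf_end (box n) f k,
        ~ inserted_pair n k f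
      & forall v, box n v -> unshift_par k f v = parent T v].
  split; first exact: represents_trees_end fT' fS' fk'.
    have [Pk Pk1] := (parent_rep fT' fS' Sk, parent_rep fT' fS' Sk1).
    case=> e [m [Sm mk fm sib]]; apply: np; split; first by rewrite -Pk.
    exists m; split=> //; first by rewrite -fm (parent_rep fT' fS').
    by move=> s Ss sk1; rewrite -!(parent_rep fT' fS') //; apply: sib.
  move=> v Sv; rewrite -fu //; apply: eq_unshift_par => // x.
  exact: parent_rep.
rewrite /shift_end (siblings_represents fT fS) //.
have -> : (k.-1 != k) = true by lia.
have [pk|pk] /= := eqVneq (parent T k.-1) (parent T k); last first.
  have [|fS' fk' npk] := swap_up k1 kn fS fk; first by rewrite eq_sym.
  exists (fun v => swap k (parent T (swap k v))); split=> //.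
  - exact: (relabel_represents (swap_bij k1 kn) fS fT).
  - by case=> e; rewrite e eqxx in npk.
  by move=> v _; rewrite /unshift_par (negbTE npk) !swapK.
have amin v : box n v -> parent T v = k -> [/\ box n (head 0 (children T k)),
    parent T (head 0 (children T k)) = k & head 0 (children T k) <= v].
  exact: (children_head_min fT fS).
have [fS' fk' f'k np un] := rearrange_par_up k1 kn fS fk (esym pk) amin.
exists (rearrange_par k (head 0 (children T k)) (parent T)); split=> //.
  exact: rearrange_represents.
by move=> v Sv; rewrite /unshift_par f'k eqxx un.
Qed.

Lemma shift_end_inj T T' : trees_end n k.-1 T -> trees_end n k.-1 T' ->
  shift_end k T = shift_end k T' -> T = T'.
Proof.
move=> tT tT' e; have [_ _ uT] := shift_end_trees_end tT.
have [_ _ uT'] := shift_end_trees_end tT'.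
apply: parent_inj; [by case: tT | by case: tT' |].
by move=> v Sv; rewrite -uT // e uT'.
Qed.

Lemma shift_end_surj T : 2 < n -> trees_end n k T ->
  ~ inserted_pair n k (parent T) ->
  exists2 T', trees_end n k.-1 T' & shift_end k T' = T.
Proof.
move=> n2 tT np; have [fT fS fk] := trees_end_represents tT.
have [Sk Sk1] := box_k.
have [pk|pk] := eqVneq (parent T k) k.-1.
  have [fS' fk' sib re] := rearrange_par_down k1 kn fS n2 fk pk np.
  have [T' tT' pT'] := trees_end_exists fS' fk'.
  exists T' => //; have [gT gS gk] := trees_end_represents tT'.
  have sib' : parent T' k = parent T' k.-1 by rewrite !pT'.
  rewrite /shift_end (siblings_represents gT gS) // -sib' eqxx andbT.
  have -> : (k.-1 != k) = true by lia.
  have := rearrange_represents gT gS k1 Sk Sk1 sib'.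
  (* [re] accepts any smallest child of k; this is the one that [rearrange] picks. *)
  set a := head 0 _ => rT.
  apply: (represents_inj (represents_eq rT _) fT fS) => v Sv.
  rewrite -(re a) //; last first.
    move=> w Sw; rewrite -pT' // => pw.
    have [Sa pa aw] := children_head_min gT gS Sw pw.
    by split; rewrite // -pT'.
  by rewrite /rearrange_par !pT'.
have [fS' fk' sib] := swap_down k1 kn fS fk pk.
have [T' tT' pT'] := trees_end_exists fS' fk'.
exists T' => //; have [gT gS gk] := trees_end_represents tT'.
rewrite /shift_end (siblings_represents gT gS) // !pT' // eq_sym [X in _ && X]eq_sym.
rewrite (negbTE sib) andbF.
have [_ _ swS _] := swap_bij k1 kn.
have := relabel_represents (swap_bij k1 kn) gS gT => rT.
apply: (represents_inj (represents_eq rT _) fT fS) => v Sv.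
by rewrite pT' ?swapK //; case: (swS v Sv).
Qed.

End Shift.
End Trees.

(** * Case (a) as an operation on trees, with its relabeling *)

(** Closed form of the order-preserving bijection from [n-2] onto [n] without k-1 and k, suited to
    [lia]. *)
Definition skip2 (k x : nat) : nat := if x < k.-1 then x else x.+2.

Definition unskip2 (k x : nat) : nat := if x < k then x else x - 2.

Lemma skip2K k : cancel (skip2 k) (unskip2 k).
Proof. by move=> x; rewrite /skip2 /unskip2; do 2?[case: ifP]; lia. Qed.

Lemma skip2_mono k x y : x < y -> skip2 k x < skip2 k y.
Proof. by rewrite /skip2; do 2?[case: ifP]; lia. Qed.

Lemma unskip2_mono n k x y : 0 < k -> hole n k x -> hole n k y -> x < y ->
  unskip2 k x < unskip2 k y.
Proof. by move=> k0; rewrite /hole /unskip2; do 2?[case: ifP]; lia. Qed.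

(** Source of the condition [k.-1 <= e] on ends and on first letters. *)
Lemma skip2_big k e : (k < skip2 k e) = (k.-1 <= e).
Proof. by rewrite /skip2; case: ifP; lia. Qed.

Lemma relabel_mono_ptree g h (S S' : pred nat) f : label_bij g h S S' ->
  (forall x y, S x -> S y -> x < y -> g x < g y) ->
  ptree S f -> ptree S' (fun v => g (f (h v))).
Proof.
move=> gh gm fS; apply: (ptree_relabel gh fS) => v Sv.
have [_ flt fcl _ _] := fS; have lt := flt v Sv.
case: (fcl v Sv) => [fv|]; last by move=> Sf; apply: gm.
(* At the root the claim is 0 < g v. Monotonicity on [S] does not reach the virtual parent, but a
   vertex sent to 0 would itself be 0. *)
have [g0 h0 gS _] := gh; rewrite fv g0 lt0n; apply/eqP => gv.
by have [_] := gS v Sv; have := ptree_pos fS Sv; rewrite gv h0; lia.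
Qed.

Lemma relabel_mono_chain g h (S S' : pred nat) f v : label_bij g h S S' ->
  (forall x y, S x -> S y -> x < y -> g x < g y) ->
  ptree S f -> on_chain S f v -> on_chain S' (fun v => g (f (h v))) (g v).
Proof.
move=> [g0 h0 gS hS] gm fS; have [_ flt fcl _ _] := fS.
have hg x : x = 0 \/ S x -> h (g x) = x by case=> [->|/gS[]//]; rewrite g0.
apply: on_chain_map => // w _ _ [Sw mw]; have [Sg hgw] := gS w Sw.
rewrite hgw; split=> //; split=> // x S'x; rewrite hgw => e.
have [Sh gh] := hS x S'x; rewrite -gh.
have : w <= h x.
  by apply: mw => //; rewrite -(hg (f w) (fcl w Sw)) -(hg _ (fcl _ Sh)) e.
by rewrite leq_eqVlt => /predU1P[->//|lt]; apply/ltnW/gm.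
Qed.

Lemma relabel_mono_leaf_end g h (S S' : pred nat) f e : label_bij g h S S' ->
  (forall x y, S x -> S y -> x < y -> g x < g y) ->
  ptree S f -> leaf_end S f e -> leaf_end S' (fun v => g (f (h v))) (g e).
Proof.
move=> gh gm fS [Se Ce leaf]; have [g0 h0 gS hS] := gh; have [_ _ fcl _ _] := fS.
split; [by case: (gS e Se) | exact: relabel_mono_chain gh gm fS Ce |].
move=> w S'w ge; have [Sh _] := hS w S'w; apply: (leaf (h w)) => //.
have hg x : x = 0 \/ S x -> h (g x) = x by case=> [->|/gS[]//]; rewrite g0.
by rewrite -(hg _ (fcl _ Sh)) ge hg //; right.
Qed.

Section AddPair.
Variables n k : nat.
Hypotheses (n2 : 1 < n) (k1 : 1 < k) (kn : k <= n).

Lemma skip2_bij : label_bij (skip2 k) (unskip2 k) (box (n - 2)) (hole n k).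
Proof.
split.
- by rewrite /skip2; case: ifP => //; lia.
- by rewrite /unskip2; case: ifP => //; lia.
- by move=> x; rewrite skip2K /box /hole /skip2; split=> //; case: ifP; lia.
by move=> y; rewrite /box /hole /skip2 /unskip2; case: ifP => ?; split=> //;
   try case: ifP => ?; lia.
Qed.

Lemma labels_butE : labels_but n k = map (skip2 k) (iota 1 (n - 2)).
Proof.
apply: (irr_sorted_eq ltn_trans ltnn).
- by apply: sorted_filter; [apply: ltn_trans | apply: iota_ltn_sorted].
- rewrite sorted_map; apply: sub_sorted (iota_ltn_sorted _ _).
  by move=> x y; apply: skip2_mono.
move=> x; rewrite mem_filter mem_iota; apply/idP/mapP => [Hx|[y + ->]].
  have [Sh gh] : box (n - 2) (unskip2 k x) /\ skip2 k (unskip2 k x) = x.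
    by case: skip2_bij => _ _ _; apply; rewrite /hole; lia.
  by exists (unskip2 k x) => //; rewrite mem_iota; move: Sh; rewrite /box; lia.
rewrite mem_iota => Hy; case: skip2_bij => _ _ /(_ y) H _.
have [|+ _] := H; first by rewrite /box; lia.
by rewrite /hole; lia.
Qed.

Lemma relab_skip2 x : box (n - 2) x ->
  relab (iota 1 (n - 2)) (labels_but n k) x = skip2 k x.
Proof.
rewrite /relab labels_butE => Sx; have xi : x \in iota 1 (n - 2).
  by rewrite mem_iota; move: Sx; rewrite /box; lia.
by rewrite (nth_map 0) ?index_mem // nth_index.
Qed.

Lemma relab_unskip2 x : hole n k x ->
  relab (labels_but n k) (iota 1 (n - 2)) x = unskip2 k x.
Proof.
move=> Sx; have [_ _ _ /(_ x Sx)[Sh gh]] := skip2_bij.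
rewrite /relab labels_butE -{1}gh index_map; last exact: can_inj (@skip2K k).
by rewrite nth_index // mem_iota; move: Sh; rewrite /box; lia.
Qed.

Let lift f := fun v => skip2 k (f (unskip2 k v)).

(** The relabeled tree has end [skip2 k e] > k, so its chain crosses k and m exists. *)
Lemma add_pair_represents e T : trees_end (n - 2) e T -> k.-1 <= e ->
  exists m, [/\ ptree (hole n k) (lift (parent T)),
    on_chain (hole n k) (lift (parent T)) m, lift (parent T) m < k < m
    & represents (box n) (insert_par k m (lift (parent T))) (add_pair n k T)].
Proof.
move=> /trees_end_represents[fT fS fe] ke.
have gm x y : box (n - 2) x -> box (n - 2) y -> x < y -> skip2 k x < skip2 k y.
  by move=> _ _; apply: skip2_mono.
have gS := relabel_mono_ptree skip2_bij gm fS.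
have [_ Ce _] := relabel_mono_leaf_end skip2_bij gm fS fe.
have gT := relabel_represents skip2_bij fS fT.
have [|m [Cm fm km _]] := on_chain_cross gS Ce (k := k); first by rewrite skip2_big.
(* The crossing only bounds the parent of m by k; equality is excluded because k is not a label. *)
have fmk : lift (parent T) m < k < m.
  have m0 : 0 < m by lia.
  have [Sm _ _] := on_chain_inv Cm m0; rewrite km andbT ltn_neqAle fm andbT.
  have [_ _ fcl _ _] := gS; apply/eqP => fmk.
  by case: (fcl m Sm); rewrite -/(lift _ m) fmk /hole ?eqxx ?andbF //; lia.
exists m; split=> //; rewrite /add_pair (eq_relabel fT fS relab_skip2).
apply: (insert_pair_represents gT gS) => //; rewrite /hole ?eqxx ?andbF //.
by move=> v; rewrite /box; lia.
Qed.

Lemma lift_inj T T' : trees (n - 2) T -> trees (n - 2) T' ->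
  (forall v, hole n k v -> lift (parent T) v = lift (parent T') v) -> T = T'.
Proof.
move=> tT tT' e; apply: parent_inj tT tT' _ => v Sv.
have [_ _ /(_ v Sv)[Sg _] _] := skip2_bij.
by have := e _ Sg; rewrite /lift skip2K => /(can_inj (@skip2K k)).
Qed.

Lemma add_pair_trees_end e T : trees_end (n - 2) e T -> k.-1 <= e ->
  trees_end n k (add_pair n k T) /\ inserted_pair n k (parent (add_pair n k T)).
Proof.
move=> tT ke; have [m [gS Cm fm rT]] := add_pair_represents tT ke.
have [fS fk [e1 [m' [Sm' mk fm' sib]]] _ _] := insert_par_up k1 kn gS Cm fm.
split; first exact: represents_trees_end rT fS fk.
have [Sk Sk1] := box_k k1 kn.
split; first by rewrite (parent_rep rT fS).
exists m'; split; rewrite ?(parent_rep rT fS) // => s Ss.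
by rewrite (parent_rep rT fS) //; apply: sib.
Qed.

(** The ends [e] and [e'] may differ a priori, since pi_3 is not prescribed. *)
Lemma add_pair_inj e e' T T' : trees_end (n - 2) e T -> k.-1 <= e ->
  trees_end (n - 2) e' T' -> k.-1 <= e' -> add_pair n k T = add_pair n k T' ->
  T = T'.
Proof.
move=> tT ke tT' ke' eT; have [m [gS Cm fm rT]] := add_pair_represents tT ke.
have [m' [gS' Cm' fm' rT']] := add_pair_represents tT' ke'.
have [fS _ _ uniq un] := insert_par_up k1 kn gS Cm fm.
have [fS' _ [_ [p [Sp pk fp _]]] uniq' un'] := insert_par_up k1 kn gS' Cm' fm'.
rewrite -eT in rT'.
have ee v : box n v ->
    insert_par k m (lift (parent T)) v = insert_par k m' (lift (parent T')) v.
  by move=> Sv; rewrite -(parent_rep rT fS Sv) (parent_rep rT' fS').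
(* Both are the only child of k-1 besides k in the common image. *)
have mm : m = m'.
  by rewrite -(uniq' p) // -(uniq p) // ee.
have [Sk Sk1] := box_k k1 kn.
apply: lift_inj; [by case: tT | by case: tT' |] => v Sv.
have Sv' : box n v by move: Sv; rewrite /box /hole; lia.
by rewrite -un // -un' // /uninsert_par mm; case: ifP => _; rewrite -mm ee // mm.
Qed.

Lemma add_pair_surj T : trees_end n k T -> inserted_pair n k (parent T) ->
  exists e T', [/\ trees_end (n - 2) e T', k.-1 <= e & add_pair n k T' = T].
Proof.
move=> /trees_end_represents[fT fS fk] [pk [m [Sm mk pm sib]]].
have [gS Cm fm ins] := insert_par_down k1 kn fS fk pk Sm mk pm sib.
set g := uninsert_par _ _ _ in gS Cm fm ins.
have Hm : hole n k m by move: Sm fm; rewrite /box /hole; lia.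
have holeN w : hole n k w -> w <= n by rewrite /hole; lia.
have [e ge me] := leaf_end_exists gS holeN Hm Cm.
have hm x y := @unskip2_mono n k x y (ltnW k1).
have bij := label_bij_sym skip2_bij.
have fS' := relabel_mono_ptree bij hm gS.
have fe' := relabel_mono_leaf_end bij hm gS ge.
have [T' tT' pT'] := trees_end_exists fS' fe'.
have [He _ _] := ge; have [_ _ _ /(_ e He)[_ gh]] := skip2_bij.
have ke : k.-1 <= unskip2 k e by rewrite -skip2_big gh; lia.
exists (unskip2 k e), T'; split=> //.
have [m' [gS' Cm' fm' rT']] := add_pair_represents tT' ke.
have lg v : hole n k v -> lift (parent T') v = g v.
  move=> Hv; have [_ _ _ hS] := skip2_bij; have [Sh ghv] := hS v Hv.
  rewrite /lift pT' // ghv; have [_ _ fcl _ _] := gS.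
  case: (fcl v Hv) => [->|/hS[_ ->] //].
  by have [g0 h0 _ _] := skip2_bij; rewrite h0 g0.
have Cm'' : on_chain (hole n k) g m'.
  suff: on_chain (hole n k) g (id m') by [].
  apply: (on_chain_map _ _ _ Cm') => // [w|w _ _ [Sw mw]].
    by case: gS' => _ + _ _ _; apply.
  by rewrite -lg //; split=> //; split=> // x Sx; rewrite -!lg //; apply: mw.
have Hm' : hole n k m'.
  have m0 : 0 < m' by lia.
  by case: (on_chain_inv Cm'' m0).
rewrite lg // in fm'.
(* Both are chain vertices at which the chain crosses k. *)
have mm : m' = m.
  have [] : g m' <= k /\ k < m' by lia.
  have [] : g m <= k /\ k < m by lia.
  move=> gm km gm' km'; apply/eqP; rewrite eqn_leq.
  by rewrite (on_chain_cross_min gS Cm'' gm' Cm km) (on_chain_cross_min gS Cm gm).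
apply: (represents_inj (represents_eq rT' _) fT fS) => v Sv.
rewrite -ins // mm /insert_par; case: ifP => // /norP[vm vk]; case: ifP => [_|vk1].
  by rewrite lg.
by rewrite lg //; move: Sv; rewrite /box /hole; lia.
Qed.

End AddPair.

(** * Alternating permutations *)

(** Removing two letters keeps the parity of the positions. *)
Lemma alternating_cons2 x y s : alternating [:: x, y & s] <->
  [/\ y < x, s != [::] -> y < head 0 s & alternating s].
Proof.
split=> [a|[yx ys a]].
  split; first exact: (a 0).
    by case: s a => [//|z s] a _; apply: (a 1).
  move=> i si; have := a i.+2; rewrite !ltnS => /(_ si) /=.
  by rewrite negbK.
case=> [|[|i]] //=; first by rewrite ltnS; case: s ys {a} => // z s ys _; apply: ys.
by rewrite !ltnS negbK; apply: a.
Qed.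

(** Only neighbouring letters must keep their order, which also covers the exchange of k-1 and k. *)
Lemma alternating_map (g : nat -> nat) s :
  (forall i (a := nth 0 s i) (b := nth 0 s i.+1), i.+1 < size s ->
     (a < b -> g a < g b) /\ (b < a -> g b < g a)) ->
  alternating s -> alternating (map g s).
Proof.
move=> gm a i; rewrite size_map => si; have [up down] := gm i si.
have := a i si; rewrite !(nth_map 0) //; last exact: ltnW.
by case: odd.
Qed.

Lemma altpermP n pi : altperm n pi <->
  [/\ uniq pi, forall x, (x \in pi) = box n x & alternating pi].
Proof.
have mi x : (x \in iota 1 n) = box n x by rewrite mem_iota /box; lia.
split=> [[p a]|[u m a]].
  split=> //; first by rewrite (perm_uniq p) iota_uniq.
  by move=> x; rewrite (perm_mem p) mi.
by split=> //; apply: uniq_perm; rewrite ?iota_uniq // => x; rewrite m mi.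
Qed.

Lemma altperm_size n pi : altperm n pi -> size pi = n.
Proof. by case=> /perm_size ->; rewrite size_iota. Qed.

Lemma altperm_inv n k pi : 1 < n -> altperm_hd n k pi ->
  exists l s, [/\ pi = [:: k, l & s], box n k, box n l & l < k].
Proof.
move=> n1 [A hk]; have := altperm_size A; have [u m a] := (altpermP n pi).1 A.
case: pi hk u m a {A} => [|x [|l s]] /=; try lia.
move=> -> u m /alternating_cons2[lk _ _] _; exists l, s; split=> //.
  by rewrite -m mem_head.
by rewrite -m !inE eqxx orbT.
Qed.

Section Words.
Variables n k : nat.
Hypotheses (k1 : 1 < k) (kn : k <= n).

(** Only the relative order of k-1 and k changes, and they are never adjacent: one of them comes
    first and is followed by [l] < k-1. The two choices of [i] serve the exchange and its
    inverse. *)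
Lemma altperm_swap (i j l : nat) s : 
  [/\ i = k & j = k.-1] \/ [/\ i = k.-1 & j = k] -> l < k.-1 ->
  altperm n [:: i, l & s] -> altperm n (map (swap k) [:: i, l & s]).
Proof.
move=> ij lk /altpermP[u m a]; apply/altpermP; split.
- by rewrite map_inj_uniq //; apply: can_inj (swapK k).
- move=> x; rewrite -{1}(swapK k x) mem_map; last exact: can_inj (swapK k).
  by rewrite m /box; have := swap_cases k x; lia.
apply: alternating_map a => -[|p] /= sp.
  have := swap_cases k i; have := swap_cases k l; lia.
have ni q : q <= size s -> nth 0 (l :: s) q <> i.
  move=> qs e; move: u; rewrite cons_uniq -e mem_nth //.
have := ni p; have := ni p.+1; rewrite /= => np1 np.
have := swap_cases k (nth 0 s p); have := swap_cases k (nth 0 (l :: s) p).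
by lia.
Qed.

Lemma mem_tail_hole s : altperm n [:: k, k.-1 & s] ->
  uniq s /\ forall x, (x \in s) = hole n k x.
Proof.
move=> /altpermP[/and3P[/= k_s k1_s us] m _]; split=> // x.
have := m x; rewrite !inE /box /hole.
have [->|] := eqVneq x k.
  by move: k_s; rewrite inE negb_or => /andP[_ /negbTE->]; lia.
have [->|] := eqVneq x k.-1; first by rewrite (negbTE k1_s) /=; lia.
by rewrite /=; lia.
Qed.

Lemma delete_pairE s : altperm n [:: k, k.-1 & s] ->
  delete_pair k [:: k, k.-1 & s] = map (unskip2 k) s.
Proof.
move=> A; have [us m] := mem_tail_hole A; rewrite /delete_pair (altperm_size A) /=.
rewrite drop0; apply/eq_in_map => x; rewrite m => Hx.
by apply: relab_unskip2 => //; lia.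
Qed.

(** pi_3 exceeds k-1 and differs from k, so it exceeds k, which after subtracting 2 is the bound
    k-1. *)
Lemma altperm_delete s : 2 < n -> altperm n [:: k, k.-1 & s] ->
  altperm (n - 2) (map (unskip2 k) s) /\ k.-1 <= head 0 (map (unskip2 k) s).
Proof.
move=> n2 A; have [us m] := mem_tail_hole A; have := altperm_size A.
have [_ _ /alternating_cons2[_ lt a]] := (altpermP _ _).1 A.
have n1 : 1 < n by lia.
have [_ _ gS hS] := skip2_bij n1 k1 kn.
have hm x y := @unskip2_mono n k x y (ltnW k1).
move=> /= sz; split; last first.
  case: s m sz lt {A us a} => [|i s] m //= sz lt; first lia.
  have : hole n k i by rewrite -m mem_head.
  by have := lt isT; rewrite /hole /unskip2; case: ifP; lia.
apply/altpermP; split.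
- rewrite map_inj_in_uniq // => x y; rewrite !m => /hS[_ {2}<-] /hS[_ {2}<-].
  by move=> ->.
- move=> x; apply/mapP/idP => [[y + ->]|Sx].
    by rewrite m => /hS[].
  by have [Hg hg] := gS x Sx; exists (skip2 k x); rewrite ?m.
apply: alternating_map a => i p q si.
have Hp : hole n k p by rewrite -m mem_nth ?(ltnW si).
have Hq : hole n k q by rewrite -m mem_nth.
by split; apply: hm.
Qed.

Lemma altperm_add w e : 2 < n -> altperm_hd (n - 2) e w -> k.-1 <= e ->
  altperm_hd n k [:: k, k.-1 & map (skip2 k) w].
Proof.
move=> n2 [A he] ke; have [u m a] := (altpermP _ _).1 A.
have n1 : 1 < n by lia.
have [_ _ gS hS] := skip2_bij n1 k1 kn.
have ms x : (x \in map (skip2 k) w) = hole n k x.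
  apply/mapP/idP => [[y + ->]|Hx]; first by rewrite m => /gS[].
  by have [Sh gh] := hS x Hx; exists (unskip2 k x); rewrite ?m.
split=> //; apply/altpermP; split.
- rewrite /= !inE !ms map_inj_uniq ?u; last exact: (can_inj (@skip2K k)).
  by rewrite /hole; lia.
- by move=> x; rewrite !inE ms /box /hole; lia.
apply/alternating_cons2; split; first by lia.
  case: w he {A u m a ms} => //= x w ->.
  by have := skip2_big k e; lia.
by apply: alternating_map a => i p q si; split; apply: skip2_mono.
Qed.

End Words.

(** * The induction *)

Lemma phi_add (k : nat) s : 0 < size s -> 0 < k ->
  phi [:: k, k.-1 & s] =
    add_pair (size s).+2 k (phi (delete_pair k [:: k, k.-1 & s])).
Proof.
by case: s => // i s _ k0; rewrite phiE prednK // eqxx.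
Qed.

Lemma phi_shift (k l : nat) s : 0 < size s -> l < k.-1 ->
  phi [:: k, l & s] = shift_end k (phi (map (swap k) [:: k, l & s])).
Proof.
case: s => // i s _ lk; rewrite phiE.
have -> : (l.+1 == k) = false by lia.
by have -> : l.+1 < k by lia.
Qed.

Lemma altperm_hd_split n k w : 1 < n -> altperm_hd n k w ->
  (exists s, w = [:: k, k.-1 & s]) \/ (exists l s, w = [:: k, l & s] /\ l < k.-1).
Proof.
move=> n1 /(altperm_inv n1)[l [s [-> Sk Sl lk]]].
have [->|/eqP lk1] := eqVneq l k.-1; first by left; exists s.
by right; exists l, s; split=> //; lia.
Qed.

Lemma parent_small n T v : n <= 2 -> trees n T -> box n v -> parent T v = v.-1.
Proof.
move=> n2 /trees_represents[fT [[r Sr fr] flt _ f0 _]] Sv; have lt := flt v Sv.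
have [v1|v1] := leqP v 1; first by move: Sv lt; rewrite /box; lia.
have S1 : box n 1 by move: Sv; rewrite /box; lia.
have p1 := flt 1 S1; have := f0 v 1 Sv S1.
by move: Sv lt; rewrite /box; lia.
Qed.

Lemma trees_end_small n k T : 0 < n -> n <= 2 -> trees_end n k T -> k = n.
Proof.
move=> n0 n2 tT; have [fT fS [Sk _ leaf]] := trees_end_represents tT.
have [|kn] := eqVneq k n; first by [].
have Sn : box n n by rewrite /box; lia.
have := leaf n Sn; rewrite (@parent_small n) //; last by case: tT.
by move: Sk kn; rewrite /box; lia.
Qed.

Lemma represents_small n T : 0 < n -> n <= 2 ->
  represents (box n) predn T -> trees_end n n T.
Proof.
move=> n0 n2 fT; have fS : ptree (box n) predn.
  split; rewrite /box; try by move=> *; lia.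
  by exists 1; rewrite //; lia.
apply: (represents_trees_end fT fS); split; first by rewrite /box; lia.
  have C1 : on_chain (box n) predn 1.
    by apply: on_chainS; [constructor | split; rewrite /box => *; lia].
  have [n1|n1] : n = 1 \/ n.-1 = 1 by lia.
    by rewrite {2}n1.
  by apply: on_chainS; [rewrite n1 | split; rewrite /box => *; lia].
by move=> w; rewrite /box; lia.
Qed.

Lemma altperm_small n w : 0 < n -> n <= 2 -> altperm n w <-> w = rev (iota 1 n).
Proof.
move=> n0 n2; have [->|->] : n = 1 \/ n = 2 by lia.
- split=> [A|->]; last first.
    by apply/altpermP; split=> // x; rewrite inE /box; lia.
  have := altperm_size A; have [_ m _] := (altpermP _ _).1 A.
  case: w m {A} => [|x [|]] //= m _; congr cons.
  by have := m x; rewrite mem_head /box; lia.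
split=> [A|->]; last first.
  apply/altpermP; split=> // [x|[|[|]]//].
  by rewrite !inE /box; lia.
have [l [s [e Sk Sl lt]]] := @altperm_inv 2 _ w isT (conj A erefl).
have := altperm_size A; rewrite e; case: s {e} => //= _.
by congr [:: _; _]; move: Sk Sl; rewrite /box; lia.
Qed.

Definition phi_bij (n k : nat) : Prop :=
  [/\ forall w, altperm_hd n k w -> trees_end n k (phi w),
      forall w w', altperm_hd n k w -> altperm_hd n k w' -> phi w = phi w' -> w = w'
    & forall T, trees_end n k T -> exists2 w, altperm_hd n k w & phi w = T].

Lemma phi_bij_small n k : 0 < n -> n <= 2 -> phi_bij n k.
Proof.
move=> n0 n2; pose w0 := rev (iota 1 n).
have h0 : head 0 w0 = n by have [e|e] : n = 1 \/ n = 2 by [lia]; rewrite /w0 e.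
have t0 : trees_end n n (phi w0).
  apply: represents_small => //.
  have [e|e] : n = 1 \/ n = 2 by lia.
    rewrite /w0 e; split=> //= [v|u v]; rewrite !inE /box; lia.
  rewrite /w0 e; split=> //= [v|u v]; rewrite !inE /box ?xpair_eqE; lia.
have e0 T : trees_end n k T -> T = phi w0.
  move=> tT; have [tT' _] := tT; have [t0' _] := t0.
  by apply: (parent_inj tT' t0') => v Sv; rewrite !(@parent_small n).
split.
- by move=> w [/(altperm_small _ n0 n2)-> <-]; rewrite h0.
- by move=> w w' [/(altperm_small _ n0 n2)-> _] [/(altperm_small _ n0 n2)-> _].
move=> T tT; exists w0; last by rewrite -(e0 T).
split; first exact/altperm_small.
by rewrite h0 (trees_end_small n0 n2 tT).
Qed.

(** Vertex 2 can only hang from 1, so 1 is not a leaf. *)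
Lemma trees_end1 n T : 1 < n -> ~ trees_end n 1 T.
Proof.
move=> n1 /trees_end_represents[_ [_ flt _ f0 _] [S1 _ leaf]].
have S2 : box n 2 by rewrite /box.
have := f0 2 1 S2 S1; have := flt 2 S2; have := flt 1 S1; have := leaf 2 S2.
by lia.
Qed.

Lemma altperm_hd1 n w : 1 < n -> ~ altperm_hd n 1 w.
Proof.
by move=> n1 /(altperm_inv n1)[l [s [_ _ Sl]]]; move: Sl; rewrite /box; lia.
Qed.

Section Step.
Variables n k : nat.
Hypotheses (n2 : 2 < n) (k1 : 1 < k) (kn : k <= n).
Hypothesis IHn : forall e, 0 < e <= n - 2 -> phi_bij (n - 2) e.
Hypothesis IHk : phi_bij n k.-1.

Let n1 : 1 < n := ltnW n2.

Lemma size_tail (x y : nat) s : altperm n [:: x, y & s] -> size s = n - 2.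
Proof. by move/altperm_size => /=; lia. Qed.

Lemma altperm_hd_delete s : altperm_hd n k [:: k, k.-1 & s] ->
  let e := head 0 (delete_pair k [:: k, k.-1 & s]) in
  [/\ altperm_hd (n - 2) e (delete_pair k [:: k, k.-1 & s]), k.-1 <= e
    & 0 < e <= n - 2].
Proof.
case=> A _; rewrite /= (delete_pairE k1 kn A).
have [A' ke] := altperm_delete k1 kn n2 A; split=> //.
have [_ m _] := (altpermP _ _).1 A'.
have : head 0 (map (unskip2 k) s) \in map (unskip2 k) s.
  by apply: head_mem; have := size_tail A; case: (s) => //=; lia.
by rewrite m.
Qed.

Lemma altperm_hd_swap l s : l < k.-1 -> altperm_hd n k [:: k, l & s] ->
  altperm_hd n k.-1 (map (swap k) [:: k, l & s]).
Proof.
move=> lk [A _]; split; first by apply: altperm_swap A; auto.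
by rewrite /=; have := swap_cases k k; lia.
Qed.

Lemma phi_pair s : altperm_hd n k [:: k, k.-1 & s] ->
  phi [:: k, k.-1 & s] = add_pair n k (phi (delete_pair k [:: k, k.-1 & s])).
Proof.
case=> A _; have sz := size_tail A; rewrite phi_add; [|lia|lia].
by congr add_pair; lia.
Qed.

Lemma phi_swap l s : l < k.-1 -> altperm_hd n k [:: k, l & s] ->
  phi [:: k, l & s] = shift_end k (phi (map (swap k) [:: k, l & s])).
Proof. by move=> lk [A _]; have sz := size_tail A; rewrite phi_shift //; lia. Qed.

Lemma phi_pair_inserted s : altperm_hd n k [:: k, k.-1 & s] ->
  trees_end n k (phi [:: k, k.-1 & s]) /\
  inserted_pair n k (parent (phi [:: k, k.-1 & s])).
Proof.
move=> A; have [A' ke en] := altperm_hd_delete A; rewrite phi_pair //.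
by have [f _ _] := IHn en; apply: add_pair_trees_end ke => //; apply: f.
Qed.

Lemma phi_swap_inserted l s : l < k.-1 -> altperm_hd n k [:: k, l & s] ->
  trees_end n k (phi [:: k, l & s]) /\
  ~ inserted_pair n k (parent (phi [:: k, l & s])).
Proof.
move=> lk A; have A' := altperm_hd_swap lk A; rewrite phi_swap //.
by have [f _ _] := IHk; case: (shift_end_trees_end k1 kn (f _ A')).
Qed.

(** [inserted_pair] reveals from the image whether pi_2 = k-1. So two words with the same image are
    of the same kind, and surjectivity splits on [inserted_pair]. *)
Lemma phi_bij_step : phi_bij n k.
Proof.
split.
- move=> w A; case: (altperm_hd_split n1 A) => [[s e]|[l [s [e lk]]]]; rewrite e in A *.
    by case: (phi_pair_inserted A).
  by case: (phi_swap_inserted lk A).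
- move=> w w' A A'.
  case: (altperm_hd_split n1 A) => [[s e]|[l [s [e lk]]]];
  case: (altperm_hd_split n1 A') => [[s' e']|[l' [s' [e' lk']]]]; subst w w'.
  + rewrite !phi_pair // => eT.
    have [D ke en] := altperm_hd_delete A; have [D' ke' en'] := altperm_hd_delete A'.
    have [f _ _] := IHn en; have [f' inj' _] := IHn en'.
    have eT' := add_pair_inj n1 k1 kn (f _ D) ke (f' _ D') ke' eT.
    have [fD' _] := (f' _ D'); have [fD fDe] := (f _ D).
    (* Induction gives injectivity for one end at a time; equal trees have equal ends, so the two
       third letters agree. *)
    have [_ ee] := f' _ D'; rewrite -eT' fDe in ee.
    have ed : delete_pair k [:: k, k.-1 & s] = delete_pair k [:: k, k.-1 & s'].
      by apply: inj' => //; rewrite -ee.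
    have [Aw _] := A; have [Aw' _] := A'; move: ed.
    rewrite (delete_pairE k1 kn Aw) (delete_pairE k1 kn Aw').
    have [_ m] := mem_tail_hole k1 kn Aw; have [_ m'] := mem_tail_hole k1 kn Aw'.
    have [_ _ _ hS] := skip2_bij n1 k1 kn.
    move/(congr1 (map (skip2 k))); rewrite -!map_comp => em.
    have idm t : (forall x, (x \in t) = hole n k x) -> map (skip2 k \o unskip2 k) t = t.
      by move=> mt; apply: map_id_in => x; rewrite mt => /hS[].
    by rewrite (idm s m) (idm s' m') in em; rewrite em.
  + move=> eT; have [_ []] := phi_swap_inserted lk' A'; rewrite -eT.
    by have [] := phi_pair_inserted A.
  + move=> eT; have [_ []] := phi_swap_inserted lk A; rewrite eT.
    by have [] := phi_pair_inserted A'.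
  rewrite (phi_swap lk A) (phi_swap lk' A').
  have D := altperm_hd_swap lk A; have D' := altperm_hd_swap lk' A'.
  have [f inj _] := IHk => /(shift_end_inj k1 kn (f _ D) (f _ D'))/(inj _ _ D D').
  by apply: inj_map; apply: can_inj (swapK k).
move=> T tT; have [ins|nins] := EM (inserted_pair n k (parent T)).
  have [e [T' [tT' ke <-]]] := add_pair_surj n1 k1 kn tT ins.
  have en : 0 < e <= n - 2 by have [_ _ []] := trees_end_represents tT'.
  have [_ _ sur] := IHn en; have [w' D <-] := sur T' tT'.
  have A := altperm_add k1 kn n2 D ke; exists [:: k, k.-1 & map (skip2 k) w'] => //.
  rewrite phi_pair //; congr (add_pair _ _ (phi _)).
  have [Aw _] := A; rewrite (delete_pairE k1 kn Aw) -map_comp.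
  by apply: map_id_in => x _; apply: skip2K.
have [T' tT' eT] := shift_end_surj k1 kn n2 tT nins.
have [_ _ sur] := IHk; have [w' D eT'] := sur T' tT'.
have [l [s [ew Sk Sl lk]]] := altperm_inv n1 D.
have A : altperm_hd n k (map (swap k) w').
  have [Aw _] := D; rewrite ew in Aw *; split; first by apply: altperm_swap Aw; auto.
  by rewrite /=; have := swap_cases k k.-1; lia.
exists (map (swap k) w') => //; rewrite -eT -eT'.
have sl : swap k l = l by have := swap_cases k l; lia.
have sk : swap k k.-1 = k by have := swap_cases k k.-1; lia.
have e' : map (swap k) w' = [:: k, l & map (swap k) s] by rewrite ew /= sl sk.
rewrite e' in A *; rewrite phi_swap // -e' -map_comp map_id_in // => x _.
exact: swapK.
Qed.

End Step.

(** The outer induction provides all ends for n-2, as (a) requires, and the inner one the end k-1,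
    as (b) requires. For n > 2 the inner one starts at k = 1, where both sides are empty. *)
Lemma phi_bijP n k : 0 < n -> box n k -> phi_bij n k.
Proof.
elim/ltn_ind: n k => n IHn k n0.
have [n2|n2] := leqP n 2; first by move=> _; apply: phi_bij_small.
have n1 := ltnW n2.
elim/ltn_ind: k => k IHk Sk; have [k1|k1] := leqP k 1.
  have -> : k = 1 by move: Sk; rewrite /box; lia.
  by split=> [w /altperm_hd1|w w' /altperm_hd1|T /trees_end1]; move/(_ n1).
have /andP[_ kn] := Sk.
apply: phi_bij_step => //; first by move=> e en; apply: IHn => //; lia.
by apply: IHk; rewrite ?/box; lia.
Qed.

Theorem theorem1 (n k : nat) (hn : 1 <= n) (hk : 1 <= k <= n) :
  set_bij (altperm_hd n k) (trees_end n k) phi /\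
  (forall pi : seq nat, altperm_hd n k pi -> head 0 pi = chain_end (phi pi)).
Proof.
have [f inj sur] := phi_bijP hn hk; split; last first.
  by move=> pi A; have [_ ->] := f pi A; case: A.
split.
- by move=> w /f.
- by move=> w w' /set_mem A /set_mem A'; apply: inj.
by move=> T /sur[w A <-]; exists w.
Qed.
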